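(* Let $\mathcal{Q}=(Q_n)_{n\ge 1}$ be a defective adapted cocycle. Assume that $\mathcal{Q}$ has a finite second moment and satisfies the second-moment deviation inequality with respect to the probability measure $\mu$. Then the law of $\frac{1}{\sqrt n}\big(Q_n-\ell(\mu;\mathcal{Q})\,n\big)$ under $\mathbb{P}^\mu$ converges weakly, as $n\to\infty$, to the Gaussian law with zero mean and variance $\sigma^2(\mu;\mathcal{Q})$ (understood as the Dirac mass at $0$ if $\sigma^2(\mu;\mathcal{Q})=0$).
   Context: Let $(G,\mathcal{G})$ be a measurable space, $\mu$ a probability measure on $G$, $\Omega=G^{\mathbb{N}^*}$ with $\mathbb{N}^*=\{1,2,\dots\}$, equipped with the product $\sigma$-field and the product measure $\mathbb{P}^\mu=\mu^{\otimes\mathbb{N}^*}$. $\mathbb{E}^\mu$ and $\mathbb{V}^\mu$ denote expectation and variance under $\mathbb{P}^\mu$. $X_n:\Omega\to G$ are the coordinate maps, $\mathcal{F}_n=\sigma(X_1,\dots,X_n)$, and $\theta_n(\omega_1,\omega_2,\dots)=(\omega_{n+1},\omega_{n+2},\dots)$. A defective adapted cocycle is a sequence $\mathcal{Q}=(Q_n)_{n\in\mathbb{N}^*}$ of real-valued maps on $\Omega$ with $Q_n$ measurable with respect to $\mathcal{F}_n$; by convention $Q_0=0$. Its defect is $\Psi_{n,m}(\omega)=Q_{n+m}(\omega)-Q_n(\omega)-Q_m(\theta_n\omega)$, $n,m\in\mathbb{N}$. Finite second moment: $\mathbb{E}^\mu[|Q_1|^2]<\infty$. Second-moment deviation inequality: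 there is a constant $\tau_2(\mu;\mathcal{Q})<\infty$ with $\mathbb{E}^\mu[|\Psi_{n,m}|^2]\le\tau_2(\mu;\mathcal{Q})$ for all $n,m\in\mathbb{N}$. Under these assumptions the limits $\ell(\mu;\mathcal{Q}):=\lim_n\frac1n\mathbb{E}^\mu[Q_n]$ (rate of escape) and $\sigma^2(\mu;\mathcal{Q}):=\lim_n\frac1n\mathbb{V}^\mu[Q_n]$ exist and are finite. *)

(* Defs.v *)
From HB Require Import structures.
From mathcomp Require Import all_boot all_order all_algebra.
From mathcomp Require Import all_classical all_reals all_analysis.
From mathcomp Require Import measurable_realfun.

Set Implicit Arguments.
Unset Strict Implicit.
Unset Printing Implicit Defensive.

Import Order.TTheory GRing.Theory Num.Theory.
Import numFieldNormedType.Exports.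

Local Open Scope classical_set_scope.
Local Open Scope ring_scope.

(* The coordinates of a sequence [w : nat -> G] are numbered from [0]: the
   coordinate map usually written X_(i+1) is [coord i]. *)
Section sequence_space.
Context {d : measure_display} (G : measurableType d).

Definition coord (i : nat) (w : nat -> G) : G := w i.

Definition coord_preimages (I : set nat) : set (set (nat -> G)) :=
  \bigcup_(i in I) preimage_set_system [set: nat -> G] (coord i) measurable.

Definition shift (n : nat) (w : nat -> G) : nat -> G := fun k => w (n + k)%N.

End sequence_space.

Arguments coord {d G}.
Arguments coord_preimages {d} G I.

(* [nat -> G] with the product sigma-algebra, resp. with the sigma-algebra
   generated by the first [n] coordinates. *)
Notation seqspace G := (g_sigma_algebraType (coord_preimages G [set: nat])).
Notation seqspace_upto G n := (g_sigma_algebraType (coord_preimages G `I_n)).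

Arguments shift {d G}.

Lemma measurable_coord d (G : measurableType d) i :
  measurable_fun [set: seqspace G] (coord i : seqspace G -> G).
Proof.
by move=> _ B mB; apply: sub_sigma_algebra; exists i => //; exists B.
Qed.

Lemma measurable_seqspace d d' (T : measurableType d') (G : measurableType d)
    (f : T -> seqspace G) :
  (forall i, measurable_fun [set: T] (fun t => f t i)) ->
  measurable_fun [set: T] f.
Proof.
move=> mf; apply: (@measurability _ _ T (seqspace G) setT f _ erefl).
move=> _ [_ [i _ [B mB <-]] <-]; rewrite !setTI.
by have := mf i measurableT B mB; rewrite setTI.
Qed.

Lemma measurable_seqspace_upto d (G : measurableType d) n (A : set (nat -> G)) :
  measurable (A : set (seqspace_upto G n)) -> measurable (A : set (seqspace G)).
Proof.
apply: smallest_sub; first exact: smallest_sigma_algebra.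
by move=> B [i _ iB]; apply: sub_sigma_algebra; exists i.
Qed.

Definition is_product_measure d (G : measurableType d) (R : realType)
    (mu : probability G R) (P : probability (seqspace G) R) :=
  forall (n : nat) (A : nat -> set G), (forall i, measurable (A i)) ->
    P (\bigcap_(i < n) coord i @^-1` A i) = (\prod_(i < n) mu (A i))%E.

(* Existence of the product measure: cylinder sets get the value of an iterated
   integral, which is shown to be sigma-subadditive and extended by
   Caratheodory's theorem. *)
Module ProductMeasure.
Section construction.
Context {d : measure_display} {G : measurableType d} {R : realType}.
Variable mu : probability G R.
Local Open Scope ereal_scope.

Local Notation Om := (seqspace G).

Implicit Types f g : Om -> \bar R.
Implicit Types A : set Om.

Definition upd (k : nat) (w : Om) (x : G) : Om :=
  fun i => if i == k then x else w i.

Definition intg (k : nat) (f : Om -> \bar R) (w : Om) : \bar R :=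
  \int[mu]_x f (upd k w x).

Fixpoint citer (k n : nat) (f : Om -> \bar R) : Om -> \bar R :=
  if n is m.+1 then intg k (citer k.+1 m f) else f.

Lemma measurable_upd k :
  measurable_fun [set: Om * G] (fun p : Om * G => upd k p.1 p.2).
Proof.
apply: measurable_seqspace => i; rewrite /upd; case: eqP => _.
  exact: measurable_snd.
exact: (measurableT_comp (measurable_coord i) measurable_fst).
Qed.

Lemma measurable_intg k f : measurable_fun setT f -> (forall w, 0 <= f w) ->
  measurable_fun setT (intg k f).
Proof.
move=> mf f0.
apply: (@measurable_fun_fubini_tonelli_F _ _ Om G R mu
  (fun p : Om * G => f (upd k p.1 p.2))) => //.
exact: (measurableT_comp mf (measurable_upd k)).
Qed.

Lemma measurable_comp_upd k f w : measurable_fun setT f ->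
  measurable_fun setT (fun x => f (upd k w x) : \bar R).
Proof.
move=> mf; apply: (measurableT_comp mf).
apply: measurable_seqspace => i; rewrite /upd; case: eqP => _ //.
Qed.

Lemma intg_ge0 k f : (forall w, 0 <= f w) -> forall w, 0 <= intg k f w.
Proof. by move=> f0 w; apply: integral_ge0. Qed.

Lemma citer_ge0 k n f : (forall w, 0 <= f w) -> forall w, 0 <= citer k n f w.
Proof. by move=> f0; elim: n k => //= n IH k; apply: intg_ge0. Qed.

Lemma measurable_citer k n f : measurable_fun setT f -> (forall w, 0 <= f w) ->
  measurable_fun setT (citer k n f).
Proof.
move=> mf f0; elim: n k => //= n IH k.
by apply: measurable_intg => //; exact: citer_ge0.
Qed.

Lemma citerD k n f g : measurable_fun setT f -> (forall w, 0 <= f w) ->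
  measurable_fun setT g -> (forall w, 0 <= g w) ->
  citer k n (f \+ g) = citer k n f \+ citer k n g.
Proof.
move=> mf f0 mg g0; elim: n k => //= n IH k.
rewrite IH; apply/funext => w; rewrite /intg /= ge0_integralD//.
- by move=> x _; exact: citer_ge0.
- by apply: measurable_comp_upd; exact: measurable_citer.
- by move=> x _; exact: citer_ge0.
- by apply: measurable_comp_upd; exact: measurable_citer.
Qed.

Definition depends (n : nat) (A : set (nat -> G)) :=
  forall w w', (forall i, (i < n)%N -> w i = w' i) -> A w -> A w'.

Lemma dependsW m n A : (m <= n)%N -> depends m A -> depends n A.
Proof.
by move=> mn dA w w' ww'; apply: dA => i im; apply: ww'; exact: leq_trans mn.
Qed.

Definition ind (A : set Om) : Om -> \bar R := fun w => (\1_A w)%:E.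

Lemma ind_ge0 A w : 0 <= ind A w. Proof. by rewrite lee_fin. Qed.
Hint Resolve ind_ge0 : core.

Lemma measurable_ind A : measurable A -> measurable_fun setT (ind A).
Proof. by move=> mA; apply/measurable_EFinP; exact: measurable_indic. Qed.

Lemma ind_upd n k A w x : depends n A -> (n <= k)%N ->
  ind A (upd k w x) = ind A w.
Proof.
move=> dA nk; rewrite /ind !indicE; congr (_%:R%:E); congr (nat_of_bool _).
have E i : (i < n)%N -> upd k w x i = w i.
  by move=> ik; rewrite /upd ltn_eqF// (leq_trans ik).
by apply/idP/idP; rewrite !inE; apply: dA => i /E.
Qed.

Lemma intg_ind n k A : depends n A -> (n <= k)%N -> intg k (ind A) = ind A.
Proof.
move=> dA nk; apply/funext => w; rewrite /intg.
under eq_integral do rewrite (ind_upd _ _ dA nk).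
by rewrite integral_cst//= probability_setT mule1.
Qed.

Lemma citer_ind n k m A : depends n A -> (n <= k)%N -> citer k m (ind A) = ind A.
Proof.
move=> dA; elim: m k => //= m IH k nk.
by rewrite IH ?leqW//; exact: intg_ind dA nk.
Qed.

Lemma citer_stable n k m m' A : depends n A -> (n <= k + m)%N -> (m <= m')%N ->
  citer k m' (ind A) = citer k m (ind A).
Proof.
move=> dA; elim: m k m' => [|m IH] k m' /=.
  by rewrite addn0 => nk _; exact: citer_ind dA nk.
by case: m' => //= m' nk mm'; rewrite (IH _ m')// addSnnS.
Qed.

(* conditional probability of [A] given the first [k] coordinates *)
Definition cexp k (A : set Om) (w : Om) : \bar R :=
  limn (fun n => citer k n (ind A) w).

Lemma cexpE n k m A w : depends n A -> (n <= k + m)%N ->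
  cexp k A w = citer k m (ind A) w.
Proof.
move=> dA nk; apply/cvg_lim => //; apply: cvg_near_cst.
by exists m => // m' /= mm'; rewrite (citer_stable dA nk mm').
Qed.

Lemma cexp_ge0 n k A w : depends n A -> 0 <= cexp k A w.
Proof.
by move=> dA; rewrite (@cexpE n k n)// ?leq_addl//; exact: citer_ge0.
Qed.

Lemma cexp_intg n k A : depends n A -> cexp k A = intg k (cexp k.+1 A).
Proof.
move=> dA; apply/funext => w; rewrite (@cexpE n k n.+1)//; last first.
  by rewrite addnS leqW// leq_addl.
rewrite /= /intg; apply: eq_integral => x _.
by rewrite (@cexpE n k.+1 n)// leq_addl.
Qed.

Lemma measurable_cexp n k A : depends n A -> measurable A ->
  measurable_fun setT (cexp k A).
Proof.
move=> dA mA; rewrite (_ : cexp k A = citer k n (ind A)); last first.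
  by apply/funext => w; rewrite (@cexpE n k n)// leq_addl.
by apply: measurable_citer => //; exact: measurable_ind.
Qed.

Lemma cexp_ind n k A w : depends n A -> (n <= k)%N -> cexp k A w = ind A w.
Proof. by move=> dA nk; rewrite (@cexpE n k 0)// addn0. Qed.

Definition cylinders : set (set (nat -> G)) :=
  [set A | measurable (A : set Om) /\ exists n, depends n A].

Definition cylT : Type := nat -> G.

Definition cyl_display : measure_display. Proof. exact: d. Qed.

Lemma cyl0 : cylinders set0.
Proof. by split; [exact: measurable0|exists 0%N]. Qed.

Lemma cylU : setU_closed cylinders.
Proof.
move=> A B [mA [n dA]] [mB [m dB]]; split; first exact: measurableU.
exists (maxn n m) => w w' ww' [Aw|Bw].
- by left; apply: (dependsW (leq_maxl n m) dA) Aw.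
- by right; apply: (dependsW (leq_maxr n m) dB) Bw.
Qed.

Lemma cylC : setC_closed cylinders.
Proof.
move=> A [mA [n dA]]; split; first exact: measurableC.
by exists n => w w' ww'; apply: contra_not; apply: dA => i /ww'.
Qed.

HB.instance Definition _ := Pointed.copy cylT (nat -> G).
HB.instance Definition _ :=
  isAlgebraOfSets.Build cyl_display cylT cyl0 cylU cylC.

Lemma cylP (A : set cylT) : measurable A ->
  measurable (A : set Om) /\ exists n, depends n A.
Proof. by []. Qed.

Definition content (A : set cylT) : \bar R :=
  if pselect (cylinders A) then cexp 0 A point else 0.

Lemma contentE (A : set cylT) : measurable A -> content A = cexp 0 A point.
Proof. by rewrite /content; case: pselect. Qed.

Lemma content_ge0 (A : set cylT) : 0 <= content A.
Proof.
rewrite /content; case: pselect => // c; have [_ [n dA]] := c.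
exact: cexp_ge0 dA.
Qed.

Lemma content0 : content set0 = 0.
Proof.
by rewrite contentE// (@cexp_ind 0%N)// /ind indic0.
Qed.

Lemma content_additive2 : additive2 content.
Proof.
rewrite -semi_additive2E => A B mA mB mAB AB0; rewrite !contentE//.
have [mA' [n dA]] := cylP mA; have [mB' [m dB]] := cylP mB.
have dA' := dependsW (leq_maxl n m) dA; have dB' := dependsW (leq_maxr n m) dB.
have dAB : depends (maxn n m) (A `|` B).
  by move=> w w' ww' [/(dA' _ _ ww')|/(dB' _ _ ww')]; [left|right].
have E C : depends (maxn n m) C ->
    cexp 0 C point = citer 0 (maxn n m) (ind C) point by move=> dC; apply: (@cexpE (maxn n m)).
rewrite (E _ dA') (E _ dB') (E _ dAB).
rewrite -[RHS]/((citer _ _ _ \+ citer _ _ _) point) -citerD//.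
- congr (citer _ _ _ _); apply/funext => w.
  rewrite /ind /= -EFinD !indicE in_setU.
  have [wA|_] := boolP (w \in A); have [wB|_] := boolP (w \in B);
    rewrite ?addr0 ?add0r//.
  by have : set0 w by rewrite -AB0; split; exact/set_mem.
- exact: measurable_ind.
- exact: measurable_ind.
Qed.

Lemma content_semi_additive : measure_function.semi_additive content.
Proof.
exact/(additive2P content0)/content_additive2.
Qed.

HB.instance Definition _ :=
  isContent.Build cyl_display cylT R content content_ge0 content_semi_additive.

(* A cylinder covered by cylinders of smaller total mass would yield, coordinate
   by coordinate, a point of the former that is outside all of the latter. *)
Lemma content_sub : measurable_subset_sigma_subadditive content.
Proof.
move=> A F mF mA AF; rewrite leNgt; apply/negP => lt0.
have [mA' [N dA]] := cylP mA.
have mF' i : measurable (F i : set Om) by have [] := cylP (mF i).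
have /choice[M dF] i : exists n, depends n (F i) by have [] := cylP (mF i).
pose S k w := \sum_(i <oo) cexp k (F i) w.
pose good k w := S k w < cexp k A w.
have S_ge0 k w : 0 <= S k w.
  by apply: nneseries_ge0 => i _ _; exact: cexp_ge0 (dF i).
have mcA k : measurable_fun setT (cexp k A) by exact: measurable_cexp dA mA'.
have mcF k i : measurable_fun setT (cexp k (F i)).
  exact: measurable_cexp (dF i) (mF' i).
have mS k : measurable_fun setT (S k).
  by apply: ge0_emeasurable_sum => // i w _ _; exact: cexp_ge0 (dF i).
have S_intg k w : S k w = intg k (S k.+1) w.
  rewrite /intg /S integral_nneseries//=.
  - by apply: eq_eseriesr => i _; rewrite (cexp_intg k (dF i)).
  - by move=> i; apply: measurable_comp_upd.
  - by move=> i x _; exact: cexp_ge0 (dF i).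
have step k w : exists x, good k w -> good k.+1 (upd k w x).
  have [gw|ngw] := pselect (good k w); last by exists point.
  suff [x gx] : exists x, good k.+1 (upd k w x) by exists x.
  apply: contrapT => nx'.
  have nx x : ~ good k.+1 (upd k w x) by move=> gx; apply: nx'; exists x.
  move: gw; rewrite /good ltNge => /negP; apply.
  rewrite S_intg (cexp_intg k dA) /intg; apply: ge0_le_integral => //.
  - by move=> x _; exact: cexp_ge0 dA.
  - by apply: measurable_comp_upd.
  - by apply: measurable_comp_upd.
  - by move=> x _; rewrite leNgt; apply/negP/nx.
have [next nextP] := @choice (nat * Om) G
  (fun p x => good p.1 p.2 -> good p.1.+1 (upd p.1 p.2 x))
  (fun p => step p.1 p.2).
pose u := fix u k := if k is j.+1 then upd j (u j) (next (j, u j)) else point : Om.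
have ugood k : good k (u k).
  elim: k => [|k IH] /=; last exact: (nextP (k, u k)).
  rewrite /good /S -contentE//; move: lt0; congr (_ < _).
  by apply: eq_eseriesr => i _; rewrite contentE.
pose w : Om := fun i => u i.+1 i.
have uw k i : (i < k)%N -> u k i = w i.
  elim: k => // k IH; rewrite ltnS leq_eqVlt => /predU1P[->//|ik].
  by rewrite /= /upd ltn_eqF// IH.
have Aw : A w.
  have := ugood N; rewrite /good (cexp_ind (u N) dA)// => h.
  have : 0 < ind A (u N) by exact: le_lt_trans h.
  rewrite /ind indicE lte_fin ltr0n lt0b inE; apply: dA => i; exact: uw.
have [i _ Fiw] := AF _ Aw.
pose K := maxn N (M i).
have := ugood K; rewrite /good (cexp_ind (u K) dA) ?leq_maxl// ltNge => /negP.
apply; apply: (@le_trans _ _ 1); first by rewrite /ind lee_fin indicE lern1 leq_b1.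
have <- : cexp K (F i) (u K) = 1.
  rewrite (cexp_ind (u K) (dF i)) ?leq_maxr// /ind indicE mem_set//.
  apply: (dF i) Fiw => j jM; rewrite uw// (leq_trans jM)//; exact: leq_maxr.
rewrite /S (@nneseriesD1 _ _ i)// ?leeDl//.
- by apply: nneseries_ge0 => j _ _; exact: cexp_ge0 (dF j).
- by move=> j _; exact: cexp_ge0 (dF j).
Qed.

HB.instance Definition _ := Content_SigmaSubAdditive_isMeasure.Build
  cyl_display R cylT content content_sub.

Let ext := measure_extension content.

Definition idc (w : g_sigma_algebraType (@measurable _ cylT)) : Om := w.

Lemma cyl_rect n (A : nat -> set G) : (forall i, measurable (A i)) ->
  cylinders (\bigcap_(i < n) coord i @^-1` A i).
Proof.
move=> mA; split; last first.
  by exists n => w w' ww' Aw i /= ij; rewrite /coord /= -ww'//; exact: Aw.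
apply: bigcap_measurableType => i _.
by rewrite -[X in measurable X]setTI; exact: measurable_coord.
Qed.

Lemma measurable_idc : measurable_fun setT idc.
Proof.
apply: measurable_seqspace => i _ B mB; apply: sub_sigma_algebra.
rewrite setTI; split.
  by rewrite -[X in measurable X]setTI; exact: measurable_coord.
by exists i.+1 => w w' ww'; rewrite /= /idc ww'.
Qed.

Lemma citer_rect k m (A : nat -> set G) w : (forall i, measurable (A i)) ->
  citer k m (ind (\bigcap_(i < k + m) coord i @^-1` A i)) w =
  ind (\bigcap_(i < k) coord i @^-1` A i) w * \prod_(i < m) mu (A (k + i)%N).
Proof.
move=> mA; elim: m k w => [|m IH] k w /=.
  by rewrite addn0 big_ord0 mule1.
rewrite /intg -addSnnS; under eq_integral do rewrite IH.
have E x : ind (\bigcap_(i < k.+1) coord i @^-1` A i) (upd k w x) =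
    ind (\bigcap_(i < k) coord i @^-1` A i) w * (\1_(A k) x)%:E.
  rewrite /ind -EFinM !indicE -natrM mulnb; congr (_%:R%:E).
  congr (nat_of_bool _); apply/idP/andP; rewrite !inE.
  - move=> h; split; last by have := h k (ltnSn k); rewrite /coord /= /upd eqxx.
    move=> i /= ik; have := h i (ltnW ik).
    by rewrite /coord /= /upd ltn_eqF.
  - move=> [h Ax] i /=; rewrite ltnS leq_eqVlt /coord /upd.
    by case: eqP => [->//|_ /= ik]; exact: h.
under eq_integral do rewrite E -muleA.
rewrite big_ord_recl addn0.
under [in RHS]eq_bigr do rewrite lift0 -addSnnS.
set C := \prod_(i < m) _.
have C0 : 0 <= C by exact: prode_ge0.
rewrite ge0_integralZl//; last 2 first.
- by apply: emeasurable_funM => //; apply/measurable_EFinP; exact: measurable_indic.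
- by move=> x _; rewrite mule_ge0// lee_fin.
rewrite ge0_integralZr//; last exact/measurable_EFinP/measurable_indic.
by rewrite integral_indic// setIT.
Qed.

Definition prodm (A : set Om) : \bar R := ext A.

Lemma measurable_ext (A : set Om) : measurable A ->
  measurable (A : set (g_sigma_algebraType (@measurable _ cylT))).
Proof. by move=> mA; have := measurable_idc measurableT mA; rewrite setTI. Qed.

Let prodm0 : prodm set0 = 0. Proof. exact: (measure0 ext). Qed.

Let prodm_ge0 A : 0 <= prodm A. Proof. exact: (measure_ge0 ext). Qed.

Let prodm_sigma_additive : semi_sigma_additive prodm.
Proof.
move=> F mF tF mUF; apply: (measure_semi_sigma_additive (s := ext)) => //.
- by move=> i; exact: measurable_ext.
- exact: measurable_ext.
Qed.

HB.instance Definition _ := isMeasure.Build _ Om R prodm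
  prodm0 prodm_ge0 prodm_sigma_additive.

Lemma prodm_rect n (A : nat -> set G) : (forall i, measurable (A i)) ->
  prodm (\bigcap_(i < n) coord i @^-1` A i) = \prod_(i < n) mu (A i).
Proof.
move=> mA; have cA := cyl_rect n mA.
rewrite /prodm /ext /measure_extension measurable_mu_extE// [LHS](contentE cA).
have dA : depends n (\bigcap_(i < n) coord i @^-1` A i).
  by move=> w w' ww' Aw i /= ij; rewrite /coord /= -ww'//; exact: Aw.
rewrite (cexpE (m := n) point dA)//.
have := @citer_rect 0 n A point mA; rewrite add0n => ->.
by rewrite bigcap_mkord big_ord0 /ind indicT mul1e.
Qed.

Let prodm_setT : prodm setT = 1.
Proof.
have := @prodm_rect 0 (fun=> setT) (fun=> measurableT).
by rewrite big_ord0 bigcap_mkord big_ord0.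
Qed.

HB.instance Definition _ :=
  Measure_isProbability.Build _ Om R prodm prodm_setT.

Lemma exists_product_measure :
  exists P : probability Om R, is_product_measure mu P.
Proof. by exists prodm => n A; exact: prodm_rect. Qed.

End construction.
End ProductMeasure.

Definition product_measure d (G : measurableType d) (R : realType)
    (mu : probability G R) : probability (seqspace G) R :=
  sval (cid (ProductMeasure.exists_product_measure mu)).

Lemma product_measureP d (G : measurableType d) (R : realType)
  (mu : probability G R) : is_product_measure mu (product_measure mu).
Proof. exact: (svalP (cid (ProductMeasure.exists_product_measure mu))). Qed.

(* No cocycle identity is imposed: its failure is measured by [defect]. *)
Record adapted_cocycle d (G : measurableType d) (R : realType) :=
  AdaptedCocycle {
    cocycle_fun :> nat -> seqspace G -> R;
    cocycle0 : forall w, cocycle_fun 0%N w = 0;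
    cocycle_adapted : forall n,
      measurable_fun [set: seqspace_upto G n]
        (cocycle_fun n : seqspace_upto G n -> R)
  }.

Section cocycle_measurability.
Context d (G : measurableType d) (R : realType) (Q : adapted_cocycle G R).

Lemma measurable_cocycle n : measurable_fun [set: seqspace G] (Q n).
Proof.
move=> _ B mB; apply: (@measurable_seqspace_upto _ G n).
exact: cocycle_adapted.
Qed.

HB.instance Definition _ n :=
  isMeasurableFun.Build _ _ _ _ (Q n) (measurable_cocycle n).

Definition normalized_cocycle (l : R) (n : nat) (w : seqspace G) :
    measurableTypeR R :=
  (Num.sqrt n%:R)^-1 * (Q n w - l * n%:R).

Lemma measurable_normalized_cocycle l n :
  measurable_fun [set: seqspace G] (normalized_cocycle l n).
Proof.
have m : measurable_fun [set: seqspace G]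
    (fun w => (Num.sqrt n%:R)^-1 * (Q n w - l * n%:R) : R).
  by apply: measurable_funM => //; apply: measurable_funB => //;
    exact: measurable_cocycle.
exact: m.
Qed.

HB.instance Definition _ l n := isMeasurableFun.Build _ _ _ _
  (normalized_cocycle l n) (measurable_normalized_cocycle l n).

End cocycle_measurability.

Section cocycle_definitions.
Context d (G : measurableType d) (R : realType).
Variables (mu : probability G R) (Q : adapted_cocycle G R).
Local Open Scope ereal_scope.

Definition defect (n m : nat) (w : seqspace G) : R :=
  (Q (n + m)%N w - Q n w - Q m (shift n w))%R.

Definition finite_second_moment :=
  'E_(product_measure mu)[(fun w => `|Q 1%N w| ^+ 2)%R] < +oo.

Definition second_moment_deviation := exists tau : R, forall n m : nat,
  'E_(product_measure mu)[(fun w => `|defect n m w| ^+ 2)%R] <= tau%:E.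

Definition rate_of_escape : R :=
  fine (limn (fun n => (n%:R^-1)%:E * 'E_(product_measure mu)[Q n])).

Definition asymptotic_variance : R :=
  fine (limn (fun n => (n%:R^-1)%:E * 'V_(product_measure mu)[Q n])).

End cocycle_definitions.

Definition weak_cvg (R : realType)
    (P_ : nat -> probability (measurableTypeR R) R)
    (P : probability (measurableTypeR R) R) :=
  forall f : R -> R, continuous f -> bounded_fun f ->
    (\int[P_ n]_x (f x)%:E)%E @[n --> \oo] --> (\int[P]_x (f x)%:E)%E.

(* [normal_prob] is parametrized by the standard deviation, and at standard
   deviation [0] it is a junk value rather than the Dirac mass. *)
Definition gaussian_law (R : realType) (v : R) :
    probability (measurableTypeR R) R :=
  if v == 0 then (\d_(0 : measurableTypeR R) : probability _ _)
  else (normal_prob 0 (Num.sqrt v) : probability _ _).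

(* Main.v *)
(** Write [q n = Q n - E (Q n)] and [c] for the square root of the constant in the
deviation inequality. The first [n] coordinates and the sequence shifted by [n]
are independent, so splitting an interval into two halves costs an error of
[L^2] norm at most [c] while the errors of the halves are orthogonal; iterating,
[q (N m)] is within [O (c sqrt N)] of the sum of the [N] independent copies
[q m o shift (j m)]. Hence [norm2 (q n) / sqrt n] is Cauchy (compare [n] and [m]
with [n m]), and, for [m] large, [q n / sqrt n] is [L^2]-close uniformly in [n] to
a normalized sum of i.i.d. variables, whose characteristic function converges to
the Gaussian one. Convergence of characteristic functions and boundedness of the
second moments give weak convergence, because a bounded continuous function is
approximated on [-M, M] by trigonometric polynomials with the same uniform bound:
take a Bernstein polynomial in [(1 + sin (x / (2 M))) / 2]. *)

From HB Require Import structures.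
Require Import Defs.
From mathcomp Require Import all_boot all_order all_algebra.
From mathcomp Require Import all_classical all_reals all_analysis.
From mathcomp Require Import measurable_realfun.
From mathcomp Require Import zify ring lra.

Set Implicit Arguments.
Unset Strict Implicit.
Unset Printing Implicit Defensive.

Import Order.TTheory GRing.Theory Num.Theory.
Import numFieldNormedType.Exports.

Local Open Scope classical_set_scope.
Local Open Scope ring_scope.

Local Notation shift := Defs.shift.
Local Notation coord := Defs.coord.

(** Removing one block at a time from [q (N m)] and using the triangle inequality adds up [N]
    defects; an error of order [c N] is too large after division by [sqrt (N m)]. Halving does
    better: the errors of the halves have mean zero and involve disjoint coordinates, so they add in
    quadrature, and [sqrt a + sqrt b] exceeds [sqrt (a + b)] by a fixed factor when [a] and [b] are
    comparable, which absorbs the extra [c] of each split. After normalization there remains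
    [O (c / sqrt m)], whatever [N] is. This orthogonality rests on exact centering, hence [q n] is
    centered at its own mean and not at [l n]. The means are additive up to a bounded error, so they
    stay within a constant of [l n], and exchanging the two centerings costs [O (1 / sqrt n)]. The
    rate of escape and the variance are defined as [fine (limn _)], so their convergence is part of
    what is proved. Characteristic functions are kept real: [cos (t x + b)] with an arbitrary phase
    [b] carries both the real and the imaginary part. *)

Lemma cvg_natV (R : realType) : (n%:R^-1 : R) @[n --> \oo] --> 0.
Proof.
have := @gtr0_cvgV0 R nat \oo _ (fun n => n%:R).
case; first by near=> n; rewrite ltr0n; near: n; exact: nbhs_infty_gt.
by move=> _; apply; exact: cvgr_idn.
Unshelve. all: by end_near. Qed.

Lemma cvg_sqrt_natV (R : realType) :
  ((Num.sqrt n%:R)^-1 : R) @[n --> \oo] --> 0.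
Proof.
have := cvg_comp _ _ (@cvg_natV R) (@sqrt_continuous R 0).
rewrite sqrtr0 /comp; apply: cvg_trans; apply: near_eq_cvg.
by near=> n; rewrite sqrtrV ?ler0n.
Unshelve. all: by end_near. Qed.

(** * Square-integrable functions on a probability space *)

Section L2.
Context d (T : measurableType d) (R : realType) (P : probability T R).
Implicit Types f g : T -> R.

Definition integrableR f := P.-integrable setT (EFin \o f).

(** Real-valued, so that estimates stay within reach of [ring] and [lra]; the link with the extended
    integral is [meanE], which asks for integrability. *)
Definition mean f : R := \int[P]_x f x.

Definition square_integrable f :=
  measurable_fun setT f /\ integrableR (fun x => f x ^+ 2).

Definition norm2 f : R := Num.sqrt (mean (fun x => f x ^+ 2)).

Lemma integrableR_measurable f : integrableR f -> measurable_fun setT f.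
Proof. by move=> /measurable_int/measurable_EFinP. Qed.

Lemma le_integrableR f g : measurable_fun setT f -> (forall x, `|f x| <= g x) ->
  integrableR g -> integrableR f.
Proof.
move=> mf fg; apply: le_integrable => //; first exact/measurable_EFinP.
by move=> x _ /=; rewrite lee_fin (le_trans (fg x))// ler_norm.
Qed.

Lemma integrableR_cst c : integrableR (fun=> c).
Proof. exact: finite_measure_integrable_cst. Qed.

Lemma integrableRD f g : integrableR f -> integrableR g ->
  integrableR (fun x => f x + g x).
Proof. by move=> sf sg; exact: (integrableD measurableT sf sg). Qed.

Lemma integrableRZ c f : integrableR f -> integrableR (fun x => c * f x).
Proof. by move=> sf; exact: (integrableZl measurableT c sf). Qed.

Lemma integrableRB f g : integrableR f -> integrableR g ->
  integrableR (fun x => f x - g x).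
Proof. by move=> sf sg; exact: (integrableB measurableT sf sg). Qed.

Lemma integrableR_norm f : integrableR f -> integrableR (fun x => `|f x|).
Proof. by move=> sf; exact: (integrable_norm sf). Qed.

Lemma integrableR_bounded f c : measurable_fun setT f ->
  (forall x, `|f x| <= c) -> integrableR f.
Proof. by move=> mf fc; apply: (le_integrableR mf fc); exact: integrableR_cst. Qed.

Lemma meanD f g : integrableR f -> integrableR g ->
  mean (fun x => f x + g x) = mean f + mean g.
Proof. by move=> sf sg; rewrite /mean RintegralD. Qed.

Lemma meanB f g : integrableR f -> integrableR g ->
  mean (fun x => f x - g x) = mean f - mean g.
Proof. by move=> sf sg; rewrite /mean RintegralB. Qed.

Lemma meanZ c f : integrableR f -> mean (fun x => c * f x) = c * mean f.
Proof. by move=> sf; rewrite /mean RintegralZl. Qed.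

Lemma mean_cst c : mean (fun=> c) = c.
Proof. by rewrite /mean Rintegral_cst//= probability_setT/= mulr1. Qed.

Lemma le_mean f g : integrableR f -> integrableR g -> (forall x, f x <= g x) ->
  mean f <= mean g.
Proof. by move=> sf sg fg; apply: le_Rintegral => // x _; exact: fg. Qed.

Lemma mean_ge0 f : (forall x, 0 <= f x) -> 0 <= mean f.
Proof. by move=> f0; apply: Rintegral_ge0. Qed.

Lemma le_norm_mean f : integrableR f -> `|mean f| <= mean (fun x => `|f x|).
Proof. by move=> sf; exact: le_normr_Rintegral. Qed.

Lemma eq_mean f g : f =1 g -> mean f = mean g.
Proof. by move=> /funext ->. Qed.

Lemma meanE f : integrableR f -> (\int[P]_x (f x)%:E)%E = (mean f)%:E.
Proof. by move=> sf; rewrite /mean /Rintegral fineK// integrable_fin_num. Qed.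

(** The product is dominated by [f^2 + g^2]. *)
Lemma integrableR_mul f g : square_integrable f -> square_integrable g ->
  integrableR (fun x => f x * g x).
Proof.
move=> [mf sf] [mg sg]; apply: (le_integrableR _ _ (integrableRD sf sg)).
  exact: measurable_funM.
by move=> x; rewrite ler_norml; apply/andP; split; nra.
Qed.

Lemma square_integrable_cst c : square_integrable (fun=> c).
Proof. by split => //; exact: integrableR_cst. Qed.

Lemma square_integrableD f g : square_integrable f -> square_integrable g ->
  square_integrable (fun x => f x + g x).
Proof.
move=> sf sg; split; first by case: sf sg => ? ? [? ?]; exact: measurable_funD.
have -> : (fun x => (f x + g x) ^+ 2) =
    (fun x => f x ^+ 2 + 2 * (f x * g x) + g x ^+ 2).
  by apply/funext => x; ring.
by apply: integrableRD; [apply: integrableRD => //; [case: sf|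
  apply: integrableRZ; exact: integrableR_mul]|case: sg].
Qed.

Lemma square_integrableZ c f : square_integrable f ->
  square_integrable (fun x => c * f x).
Proof.
move=> [mf sf]; split; first exact: measurable_funM.
by under eq_fun do rewrite exprMn; exact: integrableRZ.
Qed.

Lemma square_integrableB f g : square_integrable f -> square_integrable g ->
  square_integrable (fun x => f x - g x).
Proof.
move=> sf sg; have -> : (fun x => f x - g x) = (fun x => f x + -1 * g x).
  by apply/funext => x; rewrite mulN1r.
by apply: square_integrableD => //; exact: square_integrableZ.
Qed.

Lemma square_integrable_integrableR f : square_integrable f -> integrableR f.
Proof.
move=> sf; have := integrableR_mul sf (square_integrable_cst 1).
by under eq_fun do rewrite mulr1.
Qed.

Lemma norm2_ge0 f : 0 <= norm2 f. Proof. exact: sqrtr_ge0. Qed.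

Lemma norm2_sqr f : norm2 f ^+ 2 = mean (fun x => f x ^+ 2).
Proof. by rewrite sqr_sqrtr// mean_ge0// => x; exact: sqr_ge0. Qed.

Lemma mean_sqrD f g : square_integrable f -> square_integrable g ->
  mean (fun x => (f x + g x) ^+ 2) =
  norm2 f ^+ 2 + 2 * mean (fun x => f x * g x) + norm2 g ^+ 2.
Proof.
move=> sf sg; rewrite !norm2_sqr.
have -> : (fun x => (f x + g x) ^+ 2) =
    (fun x => f x ^+ 2 + 2 * (f x * g x) + g x ^+ 2).
  by apply/funext => x; ring.
have sfg := integrableR_mul sf sg.
case: sf sg => _ sf [_ sg].
by rewrite meanD// ?meanD// ?meanZ//; repeat apply: integrableRD => //;
  exact: integrableRZ.
Qed.

Lemma norm2Z c f : square_integrable f ->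
  norm2 (fun x => c * f x) = `|c| * norm2 f.
Proof.
move=> [_ sf]; rewrite /norm2; under eq_fun do rewrite exprMn.
by rewrite meanZ// sqrtrM ?sqr_ge0// sqrtr_sqr.
Qed.

Lemma norm2_cst c : norm2 (fun=> c) = `|c|.
Proof. by rewrite /norm2 mean_cst sqrtr_sqr. Qed.

(* The quadratic form [(a, b) |-> ||a f + b g||^2] is nonnegative, so its
   discriminant is nonpositive. *)
Lemma cauchy_schwarz_mean f g : square_integrable f -> square_integrable g ->
  `|mean (fun x => f x * g x)| <= norm2 f * norm2 g.
Proof.
move=> sf sg; set B := mean _; set a := norm2 f; set c := norm2 g.
have q u v : 0 <= u ^+ 2 * a ^+ 2 + 2 * (u * v * B) + v ^+ 2 * c ^+ 2.
  have := mean_sqrD (square_integrableZ u sf) (square_integrableZ v sg).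
  have -> : mean (fun x => u * f x * (v * g x)) = u * v * B.
    rewrite -meanZ//; last exact: integrableR_mul.
    by apply: eq_mean => x; ring.
  rewrite !norm2Z// !exprMn !real_normK ?num_real//.
  by move=> <-; apply: mean_ge0 => x; exact: sqr_ge0.
have a0 : 0 <= a by exact: norm2_ge0.
have c0 : 0 <= c by exact: norm2_ge0.
rewrite -(@ler_pXn2r _ 2)// ?nnegrE ?mulr_ge0//.
rewrite real_normK ?num_real// exprMn.
(* If [c = 0], the form at [(B, -(a^2 + 1))] equals [-B^2 (a^2 + 2)], which forces [B = 0].
   Otherwise [-B] minimizes the form in its second variable when the first one is [c^2], and the
   value there is [c^2 (a^2 c^2 - B^2)]. *)
have [c2|c2] := eqVneq (c ^+ 2) 0.
  have := q B (- (a ^+ 2 + 1)); rewrite c2; nra.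
have c2_gt0 : 0 < c ^+ 2 by rewrite lt0r c2 sqr_ge0.
have := q (c ^+ 2) (- B).
rewrite (_ : _ + _ = c ^+ 2 * (a ^+ 2 * c ^+ 2 - B ^+ 2)); last by ring.
by rewrite pmulr_rge0// subr_ge0.
Qed.

Lemma norm2D f g : square_integrable f -> square_integrable g ->
  norm2 (fun x => f x + g x) <= norm2 f + norm2 g.
Proof.
move=> sf sg; have a0 := norm2_ge0 f; have c0 := norm2_ge0 g.
rewrite -(@ler_pXn2r _ 2)// ?nnegrE ?addr_ge0 ?norm2_ge0//.
rewrite norm2_sqr mean_sqrD//.
have := cauchy_schwarz_mean sf sg; rewrite ler_norml => /andP[_]; nra.
Qed.

Lemma ler_dist_norm2 f g : square_integrable f -> square_integrable g ->
  `|norm2 f - norm2 g| <= norm2 (fun x => f x - g x).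
Proof.
move=> sf sg; rewrite ler_distl.
have sfg := square_integrableB sf sg; have sgf := square_integrableB sg sf.
have e : norm2 (fun x => g x - f x) = norm2 (fun x => f x - g x).
  by congr Num.sqrt; apply: eq_mean => x; rewrite -sqrrN opprB.
have := norm2D sfg sg; have := norm2D sgf sf.
under eq_fun do rewrite subrK.
under [X in _ -> norm2 X <= _ -> _]eq_fun do rewrite subrK.
by rewrite e; lra.
Qed.

(** Cauchy-Schwarz against the constant [1]. *)
Lemma mean_norm_le_norm2 f : square_integrable f ->
  mean (fun x => `|f x|) <= norm2 f.
Proof.
move=> sf; have nf : square_integrable (fun x => `|f x|).
  case: sf => mf sf; split; first exact: measurableT_comp.
  by under eq_fun do rewrite real_normK ?num_real//.
have := cauchy_schwarz_mean nf (square_integrable_cst 1).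
rewrite norm2_cst normr1 mulr1; under eq_fun do rewrite mulr1.
have -> : norm2 (fun x => `|f x|) = norm2 f.
  by congr Num.sqrt; apply: eq_mean => x; rewrite real_normK ?num_real.
by rewrite ger0_norm// mean_ge0.
Qed.

Lemma norm_mean_le_norm2 f : square_integrable f -> `|mean f| <= norm2 f.
Proof.
move=> sf; apply: le_trans (mean_norm_le_norm2 sf).
exact/le_norm_mean/square_integrable_integrableR.
Qed.

(** Expanding the square leaves [norm2 f ^ 2 - mean f ^ 2]. Thus centering a cocycle does not spoil
    the bound on its defect. *)
Lemma norm2_center f : square_integrable f ->
  norm2 (fun x => f x - mean f) <= norm2 f.
Proof.
move=> sf; rewrite -(@ler_pXn2r _ 2)// ?nnegrE ?norm2_ge0//.
rewrite norm2_sqr mean_sqrD//; last exact: (square_integrable_cst (- mean f)).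
rewrite norm2_cst normrN real_normK ?num_real//.
have -> : mean (fun x => f x * - mean f) = - mean f ^+ 2.
  under eq_fun do rewrite mulrC.
  by rewrite meanZ; [ring|exact: square_integrable_integrableR].
have := sqr_ge0 (mean f); lra.
Qed.

End L2.

(** * Independence under the product measure *)

Section sequence_space.
Context d (G : measurableType d) (R : realType) (mu : probability G R).
Local Notation Om := (seqspace G).
Local Notation P := (product_measure mu).

Definition agree n (w w' : nat -> G) := forall i, (i < n)%N -> w i = w' i.

(** Pointwise form of dependence on the first [n] coordinates. Joined to measurability for the full
    product field it yields independence from [shift n], and it passes through sums and compositions
    more easily than measurability for a sub-sigma-algebra. *)
Definition prefix_determined (U : Type) n (f : (nat -> G) -> U) :=
  forall w w', agree n w w' -> f w = f w'.

Lemma measurable_shift n : measurable_fun setT (shift n : Om -> Om).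
Proof. by apply: measurable_seqspace => i; exact: measurable_coord. Qed.

(** The unions of classes of [agree n] form a sigma-algebra (complements use the symmetry of
    [agree n]) that contains the generators. *)
Lemma seqspace_upto_determined n (A : set (seqspace_upto G n)) :
  measurable A -> forall w w', agree n w w' -> A w -> A w'.
Proof.
move=> mA; suff : (<<s coord_preimages G `I_n >>) `<=`
    [set A | forall w w', agree n w w' -> A w -> A w'] by apply.
have agC w w' : agree n w w' -> agree n w' w by move=> ag i /ag ->.
apply: smallest_sub; first split.
- by move=> w w1 ag [].
- move=> B /= BP w w' ag [_ nBw]; split => // Bw'; apply: nBw.
  by apply: BP Bw'; exact: agC.
- by move=> F FP w w' ag [i _ Fiw]; exists i => //; exact: (FP i w).
- move=> _ [i /= iN [B _ <-]] w w' ag; rewrite !setTI /= /coord.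
  by rewrite /preimage/= /coord (ag _ iN).
Qed.

(** The level set of [Q n] through [w] is the preimage of a measurable singleton, hence a union of
    classes of [agree n]. *)
Lemma cocycle_prefix_determined (Q : adapted_cocycle G R) n :
  prefix_determined n (Q n).
Proof.
move=> w w' ag; apply/esym.
have := @cocycle_adapted _ _ _ Q n measurableT [set Q n w].
rewrite setTI => /(_ (measurable_set1 _)) m.
exact: (seqspace_upto_determined m ag).
Qed.

(** Independence of the prefix and the shifted sequence is encoded by the fact that this gluing map
    sends [P \x P] to [P], see [pushforward_splice]. *)
Definition splice n (p : Om * Om) : Om :=
  fun i => if (i < n)%N then p.1 i else p.2 (i - n)%N.

Lemma measurable_splice n : measurable_fun setT (splice n).
Proof.
apply: measurable_seqspace => i; rewrite /splice; case: ltnP => _.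
  exact: (measurableT_comp (measurable_coord i) measurable_fst).
exact: (measurableT_comp (measurable_coord (i - n)) measurable_snd).
Qed.

Lemma shift_splice n p : shift n (splice n p) = p.2.
Proof.
by apply/funext => i; rewrite /shift /splice ltnNge leq_addr /= addKn.
Qed.

Lemma agree_splice n p : agree n (splice n p) p.1.
Proof. by move=> i ni; rewrite /splice ni. Qed.

Definition boxes : set (set Om) :=
  [set B | exists n A, (forall i, measurable (A i : set G)) /\
    B = \bigcap_(i < n) coord i @^-1` A i].

Lemma box_widen n m (A : nat -> set G) : (n <= m)%N ->
  \bigcap_(i < n) coord i @^-1` A i =
  \bigcap_(i < m) coord i @^-1` (if (i < n)%N then A i else setT).
Proof.
move=> nm; apply/seteqP; split => w Aw i /= im.
  by case: ifPn => // ni; exact: Aw.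
have := Aw i (leq_trans im nm); by rewrite /= im.
Qed.

Lemma boxes_setI : setI_closed boxes.
Proof.
move=> _ _ [n [A [mA ->]]] [m [B [mB ->]]].
rewrite (box_widen A (leq_maxl n m)) (box_widen B (leq_maxr n m)).
exists (maxn n m).
exists (fun i => (if (i < n)%N then A i else setT) `&`
                 (if (i < m)%N then B i else setT)); split.
  by move=> i; apply: measurableI; case: ifP.
by rewrite -bigcapI; apply: eq_bigcapr => i _; rewrite preimage_setI.
Qed.

Lemma measurable_box n (A : nat -> set G) : (forall i, measurable (A i)) ->
  measurable (\bigcap_(i < n) coord i @^-1` A i : set Om).
Proof.
move=> mA; apply: bigcap_measurableType => i _.
by rewrite -[X in measurable X]setTI; exact: measurable_coord.
Qed.

Lemma boxes_generate : (measurable : set (set Om)) = <<s boxes >>.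
Proof.
apply/seteqP; split.
  apply: smallest_sub; first exact: smallest_sigma_algebra.
  move=> _ [i _ [B mB <-]]; apply: sub_sigma_algebra; rewrite setTI.
  exists i.+1, (fun j => if j == i then B else setT); split.
    by move=> j; case: ifP.
  apply/seteqP; split => w /=.
    by move=> Bw j _ /=; case: eqP => [->|].
  by move/(_ i (ltnSn i)) => /=; rewrite eqxx.
apply: smallest_sub; first exact: sigma_algebra_measurable.
by move=> _ [n [A [mA ->]]]; exact: measurable_box.
Qed.

(** Dynkin's uniqueness theorem for an intersection-stable generating family; the box of length [0]
    is the whole space and serves as the covering by sets of finite measure. *)
Lemma probability_boxes_unique (P1 P2 : {measure set Om -> \bar R}) :
  P1 setT = 1%E -> (forall B, boxes B -> P1 B = P2 B) ->
  forall A, measurable A -> P1 A = P2 A.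
Proof.
move=> P1T P12; apply: (measure_unique boxes (fun=> setT)) => //.
- exact: boxes_generate.
- exact: boxes_setI.
- move=> _; exists 0%N, (fun=> setT); split => //.
  by apply/seteqP; split => // w _ i.
- by rewrite bigcup_const//; exists 0%N.
- by move=> _; apply: (@le_lt_trans _ _ 1%E); rewrite ?P1T ?ltry.
Qed.

HB.instance Definition _ n :=
  isMeasurableFun.Build _ _ _ _ (splice n) (measurable_splice n).

(** By uniqueness it suffices to look at boxes, whose preimage is a product of two boxes; both sides
    are then the same product of values of [mu], cut at [n]. *)
Lemma pushforward_splice n (A : set Om) : measurable A ->
  pushforward (P \x P)%E (splice n) A = P A.
Proof.
move=> mA; apply/esym; move: A mA; apply: probability_boxes_unique => //.
  exact: probability_setT.
move=> _ [m [A [mA ->]]].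
set A' := fun i => if (i < m)%N then A i else setT.
have mA' i : measurable (A' i) by rewrite /A'; case: ifP.
(* Padding to length [n + m] lets the box be cut at [n] whatever the order of [m] and [n]. *)
have -> : \bigcap_(i < m) coord i @^-1` A i =
    \bigcap_(i < n + m) coord i @^-1` A' i.
  by rewrite (box_widen A (leq_addl n m)).
transitivity ((P \x P)%E ((\bigcap_(i < n) coord i @^-1` A' i) `*`
   (\bigcap_(i < m) coord i @^-1` A' (n + i)%N))); last first.
  congr ((P \x P)%E _); apply/seteqP; split; last first.
    move=> [w w'] /= h; split => i /= im.
      have := h i (leq_trans im (leq_addr _ _)).
      by rewrite /coord /splice /= im.
    have := h (n + i)%N; rewrite /= ltn_add2l => /(_ im).
    by rewrite /coord /splice ltnNge leq_addr /= addKn.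
  move=> [w w'] /= [h h'] i /= im; rewrite /coord /splice /=.
  case: ltnP => ni; first exact: h.
  have := h' (i - n)%N; rewrite /= /coord subnKC//; apply.
  by rewrite ltn_subLR.
rewrite product_measure1E//; try exact: measurable_box.
transitivity (\prod_(i < n + m) mu (A' i))%E.
  exact: (product_measureP mu (n + m)%N mA').
rewrite big_split_ord /=; congr (_ * _)%E; apply/esym.
  exact: (product_measureP mu n mA').
exact: (product_measureP mu m (A := fun i => A' (n + i)%N) (fun i => mA' _)).
Qed.

(** After transport by [splice n] the product becomes [f p.1 * g p.2], to which Tonelli (for
    integrability) and Fubini (for the value) apply. *)
Lemma meanM_shift n (f g : Om -> R) : prefix_determined n f ->
  integrableR P f -> integrableR P g ->
  integrableR P (fun w => f w * g (shift n w)) /\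
  mean P (fun w => f w * g (shift n w)) = mean P f * mean P g.
Proof.
move=> fn sf sg.
have mf := integrableR_measurable sf; have mg := integrableR_measurable sg.
have mfg : measurable_fun setT (fun w => f w * g (shift n w)).
  by apply: measurable_funM => //; exact: (measurableT_comp mg (measurable_shift n)).
pose k (p : Om * Om) : \bar R := (f p.1 * g p.2)%:E.
have mk : measurable_fun setT k.
  apply/measurable_EFinP; apply: measurable_funM.
    exact: (measurableT_comp mf measurable_fst).
  exact: (measurableT_comp mg measurable_snd).
have kE p : (f (splice n p) * g (shift n (splice n p)))%:E = k p.
  by rewrite /k shift_splice (fn _ p.1)//; exact: agree_splice.
have sk : (P \x P)%E.-integrable setT k.
  apply/integrable12ltyP => //.
  rewrite (eq_integral (fun x => `|f x|%:E * (mean P (fun y => `|g y|))%:E)%E).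
    rewrite integralZr//; last exact: integrableR_norm.
    by rewrite meanE ?ltry//; exact: integrableR_norm.
  move=> x _; rewrite -meanE; last exact: integrableR_norm.
  rewrite -integralZl//; last exact: integrableR_norm.
  by apply: eq_integral => y _; rewrite /k /= normrM EFinM.
pose h w : \bar R := (f w * g (shift n w))%:E.
have hE : h \o splice n = k by apply/funext => p; exact: kE.
have mh : measurable_fun setT h by exact/measurable_EFinP.
have sh : (P \x P)%E.-integrable (splice n @^-1` setT) (h \o splice n).
  by rewrite hE preimage_setT.
have PE (u : Om -> \bar R) :
    (\int[P]_w u w = \int[pushforward (P \x P)%E (splice n)]_w u w)%E.
  by apply: eq_measure_integral => A mA _; exact/esym/pushforward_splice.
have sP : P.-integrable setT h.
  apply/integrableP; split => //; rewrite PE.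
  have := integrable_pushforward (measurable_splice n) mh sh measurableT.
  by case/integrableP.
split; first exact: sP.
rewrite /mean /Rintegral PE.
rewrite (integral_pushforward (measurable_splice n) mh sh)//.
rewrite hE preimage_setT -integral12_prod_meas1// /fubini_F.
rewrite (eq_integral (fun x => (f x)%:E * (mean P g)%:E)%E).
  by rewrite integralZr// fineM ?integrable_fin_num.
by move=> x _; rewrite -meanE// -integralZl.
Qed.

Lemma integrableR_shift n (g : Om -> R) : integrableR P g ->
  integrableR P (fun w => g (shift n w)).
Proof.
move=> sg; have e : (fun w => 1 * g (shift n w)) = (fun w => g (shift n w)).
  by apply/funext => w; rewrite mul1r.
have [+ _] := meanM_shift (n := n) (f := fun=> 1)
  (fun _ _ _ => erefl) (integrableR_cst _ 1) sg.
by rewrite e.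
Qed.

Lemma mean_shift n (g : Om -> R) : integrableR P g ->
  mean P (fun w => g (shift n w)) = mean P g.
Proof.
move=> sg; have e : (fun w => 1 * g (shift n w)) = (fun w => g (shift n w)).
  by apply/funext => w; rewrite mul1r.
have [_] := meanM_shift (n := n) (f := fun=> 1)
  (fun _ _ _ => erefl) (integrableR_cst _ 1) sg.
by rewrite e mean_cst mul1r.
Qed.

Lemma square_integrable_shift n (g : Om -> R) : square_integrable P g ->
  square_integrable P (fun w => g (shift n w)).
Proof.
move=> [mg sg]; split; last exact: integrableR_shift sg.
exact: (measurableT_comp mg (measurable_shift n)).
Qed.

Lemma norm2_shift n (g : Om -> R) : square_integrable P g ->
  norm2 P (fun w => g (shift n w)) = norm2 P g.
Proof. by move=> [mg sg]; rewrite /norm2 (mean_shift n sg). Qed.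

(** Pythagoras: the cross term is [mean f * mean g] by independence, and [f] is centered. *)
Lemma norm2D_shift n (f g : Om -> R) : prefix_determined n f ->
  square_integrable P f -> square_integrable P g -> mean P f = 0 ->
  norm2 P (fun w => f w + g (shift n w)) ^+ 2 = norm2 P f ^+ 2 + norm2 P g ^+ 2.
Proof.
move=> fn sf sg f0; have sgn := square_integrable_shift n sg.
rewrite norm2_sqr mean_sqrD// norm2_shift//.
have [_ ->] := meanM_shift fn (square_integrable_integrableR sf)
  (square_integrable_integrableR sg).
by rewrite f0 mul0r mulr0 addr0.
Qed.

End sequence_space.

(** * Second-order estimates of the trigonometric functions *)

Section elementary_bounds.
Context (R : realType).
Implicit Types u x y : R.

(** Mean value inequality. The bound on [df] is asked on a ball around [a], so that with [a = 0]
    both signs of [b] are treated at once. *)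
Lemma ler_dist_derive (f df : R -> R) (a b K : R) :
  (forall x : R, is_derive x (1 : R) f (df x)) ->
  (forall x, `|x - a| <= `|b - a| -> `|df x| <= K) ->
  `|f b - f a| <= K * `|b - a|.
Proof.
move=> fdf dfK.
have cf : continuous f.
  by move=> x; apply/differentiable_continuous/derivable1_diffP.
have [ab|ba|->] := ltgtP a b; last by rewrite !subrr normr0 mulr0.
- have [z zab ->] := @MVT R f df a b ab (fun x _ => fdf x)
    (continuous_subspaceT cf).
  rewrite normrM ler_wpM2r// dfK//; move: zab; rewrite in_itv /= => /andP[az zb].
  by rewrite (ger0_norm (_ : 0 <= z - a)) ?(ger0_norm (_ : 0 <= b - a)); lra.
- have [z zab] := @MVT R f df b a ba (fun x _ => fdf x)
    (continuous_subspaceT cf).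
  rewrite -(normrN (f b - _)) opprB => ->.
  rewrite normrM (distrC b a) ler_wpM2r// dfK//.
  move: zab; rewrite in_itv /= => /andP[bz za].
  rewrite (distrC b) (distrC z).
  by rewrite (ger0_norm (_ : 0 <= a - z)) ?(ger0_norm (_ : 0 <= a - b)); lra.
Qed.

Lemma cos_dist_le x y : `|cos x - cos y| <= `|x - y|.
Proof.
rewrite -[leRHS]mul1r; apply: (@ler_dist_derive _ (fun x => - sin x)) => z _.
by rewrite normrN sin_max.
Qed.

Lemma sin_norm_le u : `|sin u| <= `|u|.
Proof.
have := @ler_dist_derive (@sin R) (@cos R) 0 u 1 _ _.
by rewrite sin0 !subr0 mul1r; apply => x _; exact: cos_max.
Qed.

Lemma cos_sub1_norm_le u : `|cos u - 1| <= Num.min `|u| (u ^+ 2).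
Proof.
rewrite le_min; apply/andP; split.
  by have := cos_dist_le u 0; rewrite cos0 subr0.
have := @ler_dist_derive (@cos R) (fun x => - sin x) 0 u `|u| _ _.
rewrite cos0 subr0 -normrM -expr2 (ger0_norm (sqr_ge0 _)); apply => x.
by rewrite subr0 normrN; apply: le_trans; exact: sin_norm_le.
Qed.

(** The remainder is cubic near [0] but only quadratic at infinity: with no more than a second
    moment at hand, [u^2] has to be the integrable majorant and the minimum the factor that tends to
    [0]. *)
Lemma sin_taylor u : `|sin u - u| <= u ^+ 2 * Num.min 1 `|u|.
Proof.
have := @ler_dist_derive (fun x => sin x - x) (fun x => cos x - 1) 0 u
  (Num.min `|u| (u ^+ 2)) _ _.
rewrite sin0 subrr !subr0 => H.
apply: le_trans (H _ _) _.
- move=> x; rewrite subr0 => xu; apply: (le_trans (cos_sub1_norm_le _)).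
  have xu2 : x ^+ 2 <= u ^+ 2.
    rewrite -(real_normK (num_real x)) -(real_normK (num_real u)).
    by rewrite lerXn2r ?nnegrE.
  by rewrite le_min !ge_min xu xu2 orbT.
- rewrite -(real_normK (num_real u)).
  have : 0 <= `|u| by [].
  move: (`|u|) => v v0; rewrite minr_pMl// minr_pMr ?sqr_ge0//.
  by rewrite mulr1 -expr2.
Qed.

(** The derivative [-(sin x - x)] is at most [2 |u|] and at most [u^2] for [|x| <= |u|]. *)
Lemma cos_taylor u :
  `|cos u - 1 + u ^+ 2 / 2| <= u ^+ 2 * (2 * Num.min 1 `|u|).
Proof.
have := @ler_dist_derive (fun x => cos x - 1 + x ^+ 2 / 2)
  (fun x => - (sin x - x)) 0 u (`|u| * (2 * Num.min 1 `|u|)) _ _.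
rewrite cos0 subrr expr0n /= mul0r add0r !subr0 => H.
apply: le_trans (H _ _) _.
- move=> x; apply: trigger_derive; rewrite /GRing.scale /=; by field.
- move=> x; rewrite subr0 normrN => xu.
  have h1 : `|sin x - x| <= `|u| * 2.
    rewrite (le_trans (ler_normB _ _))//.
    have := sin_norm_le x; lra.
  have h2 : `|sin x - x| <= `|u| * `|u|.
    apply: (le_trans (sin_taylor _)).
    rewrite -expr2 -(real_normK (num_real x)).
    rewrite (@le_trans _ _ (`|x| ^+ 2))//.
      by rewrite ler_piMr ?sqr_ge0// ge_min lexx.
    by rewrite ler_pXn2r ?nnegrE.
  have : 0 <= `|u| by []; move: h1 h2.
  move: (`|u|) => v h1 h2 v0.
  by rewrite /Num.min; case: ltP => _; nra.
- by rewrite [leLHS]mulrC mulrA -expr2 real_normK ?num_real.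
Qed.

(** The exponential lies between [1 - x] and [1 / (1 + x)], which differ by [x^2 / (1 + x)]. *)
Lemma expR_taylor x : 0 <= x -> `|expR (- x) - (1 - x)| <= x ^+ 2.
Proof.
move=> x0; have h := expR_ge1Dx (- x).
rewrite ger0_norm; last by lra.
have : expR (- x) <= (1 + x)^-1.
  by rewrite expRN lef_pV2 ?posrE ?expR_gt0 ?expR_ge1Dx//; lra.
move=> /le_trans h2; rewrite lerBlDr; apply: h2.
have x1 : 0 < 1 + x by lra.
by rewrite -[leLHS]mul1r ler_pdivrMr//; nra.
Qed.

Lemma expRN_dist_le x y : 0 <= x -> 0 <= y ->
  `|expR (- x) - expR (- y)| <= `|x - y|.
Proof.
wlog xy : x y / x <= y.
  by have [xy|/ltW yx] := leP x y => H x0 y0;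
    [exact: H|rewrite distrC (distrC x); exact: H].
move=> x0 y0; rewrite (distrC x) (ger0_norm (_ : 0 <= y - x)) ?subr_ge0//.
have -> : expR (- x) - expR (- y) = expR (- x) * (1 - expR (- (y - x))).
  by rewrite mulrBr mulr1 -expRD; congr (_ - expR _); ring.
have h := expR_ge1Dx (- (y - x)).
have h1 : expR (- (y - x)) <= 1 by rewrite -expR0 ler_expR; lra.
have h2 : expR (- x) <= 1 by rewrite -expR0 ler_expR; lra.
rewrite normrM ger0_norm ?expR_ge0// ger0_norm ?subr_ge0//.
have := expR_ge0 (- x); nra.
Qed.

End elementary_bounds.

(** * Characteristic functions *)

Section clt.
Context d (G : measurableType d) (R : realType) (mu : probability G R).
Local Notation Om := (seqspace G).
Local Notation P := (product_measure mu).

Lemma measurable_cos_comp (f : Om -> R) (t b : R) : measurable_fun setT f ->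
  measurable_fun setT (fun w => cos (t * f w + b)).
Proof.
move=> mf; apply: (measurableT_comp (continuous_measurable_fun (@continuous_cos R))).
by apply: measurable_funD => //; exact: measurable_funM.
Qed.

Lemma integrableR_cos (f : Om -> R) (t b : R) : measurable_fun setT f ->
  integrableR P (fun w => cos (t * f w + b)).
Proof.
move=> mf; apply: (integrableR_bounded _ (measurable_cos_comp t b mf)) => w.
exact: cos_max.
Qed.

Lemma sin_cos_shift (x : R) : sin x = cos (x + - (pi / 2)).
Proof. by rewrite cosB cos_pihalf sin_pihalf mulr0 add0r mulr1. Qed.

Lemma integrableR_sin (f : Om -> R) (t b : R) : measurable_fun setT f ->
  integrableR P (fun w => sin (t * f w + b)).
Proof.
move=> mf; have := integrableR_cos t (b - pi / 2) mf.
by congr integrableR; apply/funext => w; rewrite sin_cos_shift addrA.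
Qed.

(** Since the cosine is 1-Lipschitz, closeness in [L^2] passes to characteristic functions,
    uniformly in the phase. *)
Lemma mean_cos_dist (f g : Om -> R) (t b : R) : square_integrable P f ->
  square_integrable P g ->
  `|mean P (fun w => cos (t * f w + b)) - mean P (fun w => cos (t * g w + b))| <=
  `|t| * norm2 P (fun w => f w - g w).
Proof.
move=> sf sg; have [mf _] := sf; have [mg _] := sg.
have sfg := square_integrableB sf sg.
have ifg := integrableR_norm (square_integrable_integrableR sfg).
have icf := integrableR_cos t b mf; have icg := integrableR_cos t b mg.
rewrite -meanB//; apply: (le_trans (le_norm_mean (integrableRB icf icg))).
apply: (@le_trans _ _ (mean P (fun w => `|t| * `|f w - g w|))).
  apply: le_mean.
  - exact/integrableR_norm/integrableRB.
  - exact: integrableRZ.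
  - move=> w; apply: (le_trans (cos_dist_le _ _)).
    by rewrite (_ : _ + b - _ = t * (f w - g w)) ?normrM//; ring.
by rewrite meanZ// ler_wpM2l// mean_norm_le_norm2.
Qed.

(** Error, real part plus imaginary part, made in replacing the characteristic function of [Y] at
    [s] by that of the centered Gaussian law with variance [norm2 P Y ^ 2]. *)
Definition char_error (Y : Om -> R) (s : R) : R :=
  `|mean P (fun w => cos (s * Y w)) - expR (- (s ^+ 2 * norm2 P Y ^+ 2 / 2))| +
  `|mean P (fun w => sin (s * Y w))|.

(** Second-order expansions: the cosine contributes twice the remainder, the sine once (its linear
    term has mean zero), and the exponential the final square. *)
Lemma char_error_le (Y : Om -> R) (s : R) : square_integrable P Y ->
  mean P Y = 0 ->
  char_error Y s <=
  mean P (fun w => 3 * ((s * Y w) ^+ 2 * Num.min 1 `|s * Y w|)) +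
  (s ^+ 2 * norm2 P Y ^+ 2 / 2) ^+ 2.
Proof.
move=> sY Y0; have [mY Y2] := sY; have iY := square_integrable_integrableR sY.
pose h w := (s * Y w) ^+ 2 * Num.min 1 `|s * Y w|.
have h0 w : 0 <= h w by rewrite mulr_ge0 ?sqr_ge0// le_min ler01 normr_ge0.
have isY2 : integrableR P (fun w => (s * Y w) ^+ 2).
  by case: (square_integrableZ s sY).
have ih : integrableR P h.
  apply: (le_integrableR _ _ isY2).
    apply: measurable_funM; first exact: (integrableR_measurable isY2).
    apply: measurable_minr => //; apply: measurableT_comp => //.
    exact: measurable_funM.
  by move=> w; rewrite ger0_norm// ler_piMr ?sqr_ge0// ge_min lexx.
have ic : integrableR P (fun w => cos (s * Y w)).
  have := integrableR_cos s 0 mY; congr integrableR; apply/funext => w.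
  by rewrite addr0.
have is_ : integrableR P (fun w => sin (s * Y w)).
  have := integrableR_sin s 0 mY; congr integrableR; apply/funext => w.
  by rewrite addr0.
set k := s ^+ 2 * norm2 P Y ^+ 2 / 2.
have k0 : 0 <= k by rewrite divr_ge0// mulr_ge0 ?sqr_ge0.
have ekE : mean P (fun w => (s * Y w) ^+ 2 / 2) = k.
  rewrite (eq_mean _ (g := fun w => s ^+ 2 / 2 * Y w ^+ 2)).
    by rewrite meanZ// -norm2_sqr /k; ring.
  by move=> w; ring.
have ik : integrableR P (fun w => (s * Y w) ^+ 2 / 2).
  have := integrableRZ 2^-1 isY2; congr integrableR; apply/funext => w.
  by rewrite mulrC.
have icm : integrableR P (fun w => cos (s * Y w) - 1 + (s * Y w) ^+ 2 / 2).
  apply: integrableRD => //; apply: integrableRB => //.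
  exact: integrableR_cst.
have ism : integrableR P (fun w => sin (s * Y w) - s * Y w).
  by apply: integrableRB => //; exact: integrableRZ.
have H1 : `|mean P (fun w => cos (s * Y w)) - (1 - k)| <=
    mean P (fun w => 2 * h w).
  have -> : mean P (fun w => cos (s * Y w)) - (1 - k) =
      mean P (fun w => cos (s * Y w) - 1 + (s * Y w) ^+ 2 / 2).
    rewrite meanD ?meanB ?mean_cst ?ekE//; [by ring|exact: integrableR_cst|].
    by apply: integrableRB => //; exact: integrableR_cst.
  apply: (le_trans (le_norm_mean icm)); apply: le_mean.
  - exact: integrableR_norm.
  - exact: integrableRZ.
  - by move=> w; rewrite (le_trans (cos_taylor _))// /h mulrCA.
have H2 : `|mean P (fun w => sin (s * Y w))| <= mean P h.
  have -> : mean P (fun w => sin (s * Y w)) = mean P (fun w => sin (s * Y w) - s * Y w).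
    by rewrite meanB ?meanZ ?Y0 ?mulr0 ?subr0//; exact: integrableRZ.
  apply: (le_trans (le_norm_mean ism)); apply: le_mean => //.
  - exact: integrableR_norm.
  - by move=> w; exact: sin_taylor.
have := expR_taylor k0 => H3.
rewrite meanZ// /char_error -/k; rewrite meanZ// in H1.
rewrite (_ : mean P (fun w => cos (s * Y w)) - expR (- k) =
   (mean P (fun w => cos (s * Y w)) - (1 - k)) - (expR (- k) - (1 - k))); last by ring.
have := ler_normB (mean P (fun w => cos (s * Y w)) - (1 - k)) (expR (- k) - (1 - k)).
lra.
Qed.

(** The factor [n] cancels the [1 / n] in [(t / sqrt n)^2]. What is left of the first term is
    [(t Y)^2] times a minimum that tends to [0], hence dominated convergence; the second term is of
    order [1 / n]. *)
Lemma cvg_char_error (Y : Om -> R) (t : R) : square_integrable P Y ->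
  mean P Y = 0 ->
  n%:R * char_error Y (t / Num.sqrt n%:R) @[n --> \oo] --> 0.
Proof.
move=> sY Y0; have [mY Y2] := sY.
pose u n w := t / Num.sqrt n%:R * Y w.
pose h n w := 3 * ((t * Y w) ^+ 2 * Num.min 1 `|u n w|).
have itY2 : integrableR P (fun w => 3 * (t * Y w) ^+ 2).
  by apply: integrableRZ; case: (square_integrableZ t sY).
have h_ge0 n w : 0 <= h n w.
  by rewrite mulr_ge0// mulr_ge0 ?sqr_ge0// le_min ler01 normr_ge0.
have h_le n w : h n w <= 3 * (t * Y w) ^+ 2.
  by rewrite ler_pM2l// ler_piMr ?sqr_ge0// ge_min lexx.
have mh n : measurable_fun setT (h n).
  apply: measurable_funM => //; apply: measurable_funM.
    by apply: measurable_funX; exact: measurable_funM.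
  apply: measurable_minr => //; apply: measurableT_comp => //.
  exact: measurable_funM.
have ih n : integrableR P (h n).
  by apply: (le_integrableR (mh n) _ itY2) => w; rewrite ger0_norm.
have hcvg : mean P (h n) @[n --> \oo] --> 0.
  suff : (\int[P]_w (h n w)%:E)%E @[n --> \oo] --> (\int[P]_w (cst 0 w))%E.
    rewrite integral0.
    rewrite (_ : (fun n => \int[P]_w (h n w)%:E)%E = (fun n => (mean P (h n))%:E)).
      by move/fine_cvg.
    by apply/funext => n; rewrite meanE.
  apply: (@dominated_cvg _ _ _ P _ measurableT _ _ (fun w => (3 * (t * Y w) ^+ 2)%:E)) => //.
  - by move=> n; apply/measurable_EFinP.
  - move=> w _; apply: cvg_EFin; first exact: nearW.
    have tw : `|u n w| @[n --> \oo] --> 0.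
      rewrite -(normr0 R); apply: cvg_norm; rewrite /u.
      rewrite -[X in _ --> X](mul0r (Y w)); apply: cvgM; last exact: cvg_cst.
      rewrite -[X in _ --> X](mulr0 t); apply: cvgM; first exact: cvg_cst.
      exact: cvg_sqrt_natV.
    apply: (@squeeze_cvgr _ _ _ _ (cst 0) (fun n => 3 * ((t * Y w) ^+ 2 * `|u n w|))).
    + near=> n; rewrite h_ge0 /= /h ler_pM2l// ler_wpM2l ?sqr_ge0//.
      by rewrite ge_min lexx orbT.
    + exact: cvg_cst.
    + rewrite -[X in _ --> X](mulr0 3); apply: cvgM; first exact: cvg_cst.
      rewrite -[X in _ --> X](mulr0 ((t * Y w) ^+ 2)).
      by apply: cvgM => //; exact: cvg_cst.
  - by move=> n w _; rewrite lee_fin ger0_norm.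
set v := norm2 P Y ^+ 2.
apply: (@squeeze_cvgr _ _ _ _ (cst 0)
  (fun n => mean P (h n) + (t ^+ 2 * v / 2) ^+ 2 * n%:R^-1)).
- near=> n; rewrite mulr_ge0 ?ler0n ?addr_ge0//=.
  have n0 : 0 < n%:R :> R by rewrite ltr0n; near: n; exact: nbhs_infty_gt.
  have sn : Num.sqrt n%:R ^+ 2 = n%:R :> R by rewrite sqr_sqrtr ?ler0n.
  have sn0 : Num.sqrt n%:R != 0 :> R by rewrite gt_eqF// sqrtr_gt0.
  apply: (le_trans (ler_wpM2l (ltW n0) (char_error_le _ sY Y0))).
  rewrite mulrDr -/v lerD//.
    rewrite -meanZ; last first.
      apply: (le_integrableR _ _ (integrableRZ n%:R^-1 itY2)).
        apply: measurable_funM => //; apply: measurable_funM.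
          by apply: measurable_funX; exact: measurable_funM.
        apply: measurable_minr => //; apply: measurableT_comp => //.
        exact: measurable_funM.
      move=> w; rewrite -/(u n w).
      have -> : u n w ^+ 2 = n%:R^-1 * (t * Y w) ^+ 2.
        by rewrite /u; move: sn sn0; move: (Num.sqrt n%:R) => z <- z0; field.
      have ni : 0 <= n%:R^-1 :> R by rewrite invr_ge0 ler0n.
      rewrite (_ : 3 * _ = n%:R^-1 * h n w); last by rewrite /h; ring.
      rewrite ger0_norm; last by apply: mulr_ge0 => //; exact: h_ge0.
      by apply: ler_wpM2l => //; exact: h_le.
    rewrite le_eqVlt; apply/orP; left; apply/eqP; apply: eq_mean => w.
    rewrite /h /u; move: (Num.min _ _) sn sn0 => m.
    by move: (Num.sqrt n%:R) => z <- z0; field.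
  rewrite le_eqVlt; apply/orP; left; apply/eqP.
  by move: sn sn0; move: (Num.sqrt n%:R) => z <- z0; field.
- exact: cvg_cst.
- rewrite -[X in _ --> X]addr0; apply: cvgD => //.
  rewrite -[X in _ --> X](mulr0 ((t ^+ 2 * v / 2) ^+ 2)).
  by apply: cvgM; [exact: cvg_cst|exact: cvg_natV].
Unshelve. all: by end_near. Qed.

End clt.

(** * Block decomposition *)

(** Each [n] is split into two nearly equal parts. Splitting off one unit at a time would only give
    [x n <= c n]. *)
Lemma sqrt_subadditive_growth (R : realType) (x : nat -> R) (c : R) : 0 <= c ->
  (forall n, 0 <= x n) -> x 1%N = 0 ->
  (forall a b, (0 < a)%N -> (0 < b)%N ->
    x (a + b)%N <= Num.sqrt (x a ^+ 2 + x b ^+ 2) + c) ->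
  forall n, (0 < n)%N -> x n <= 80 * c * Num.sqrt n%:R.
Proof.
move=> c0 x0 x1 xD.
(* The additive constant has to be absorbed: the bound that is stable under
   splitting [n] into two halves is [80 c sqrt n - 5 c]. *)
suff H n : (0 < n)%N -> x n <= 80 * c * Num.sqrt n%:R - 5 * c.
  by move=> n /H; lra.
elim/ltn_ind: n => n IH n0.
have [n2|n2] := leqP n 1.
  have -> : n = 1%N by apply/eqP; rewrite eqn_leq n2 n0.
  by rewrite x1 sqrtr1; lra.
set a := (n %/ 2)%N; set b := (n - a)%N.
have nab : n = (a + b)%N by rewrite /b subnKC// leq_div.
have an : (a * 2 <= n)%N by exact: leq_trunc_div.
have na : (n < a.+1 * 2)%N by exact: ltn_ceil.
have a0 : (0 < a)%N by rewrite divn_gt0.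
have b0 : (0 < b)%N by lia.
have a3 : (n <= 3 * a)%N by lia.
have b2 : (n <= 2 * b)%N by lia.
have xa := IH a ltac:(lia) a0; have xb := IH b ltac:(lia) b0.
move: xa xb (xD a b a0 b0); rewrite -nab.
set al := Num.sqrt a%:R; set be := Num.sqrt b%:R; set nu := Num.sqrt n%:R.
have al0 : 0 <= al by exact: sqrtr_ge0.
have be0 : 0 <= be by exact: sqrtr_ge0.
have nu0 : 0 <= nu by exact: sqrtr_ge0.
have al2 : al ^+ 2 = a%:R by rewrite sqr_sqrtr.
have be2 : be ^+ 2 = b%:R by rewrite sqr_sqrtr.
have nu2 : nu ^+ 2 = n%:R by rewrite sqr_sqrtr.
have nuE : nu ^+ 2 = al ^+ 2 + be ^+ 2 by rewrite al2 be2 nu2 -natrD -nab.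
have sqr_le (y z : R) : 0 <= z -> y ^+ 2 <= z ^+ 2 -> y <= z.
  move=> z_ge0 yz; have := ler_wsqrtr yz.
  by rewrite !sqrtr_sqr (ger0_norm z_ge0); apply: le_trans; exact: ler_norm.
(* [57/100] and [7/10] are rational lower bounds of [1 / sqrt 3] and [1 / sqrt 2], coming from
   [a >= n / 3] (worst case [n = 3]) and [b >= n / 2]. Their sum exceeds [1], and this excess pays
   for the extra [c]. *)
have al_nu : 57/100 * nu <= al.
  apply: sqr_le => //.
  have : nu ^+ 2 <= 3 * al ^+ 2 by rewrite nu2 al2 -natrM ler_nat.
  by rewrite exprMn; have := sqr_ge0 nu; lra.
have be_nu : 7/10 * nu <= be.
  apply: sqr_le => //.
  have : nu ^+ 2 <= 2 * be ^+ 2 by rewrite nu2 be2 -natrM ler_nat.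
  by rewrite exprMn; have := sqr_ge0 nu; lra.
have nu1 : 1 <= nu by rewrite -sqrtr1 ler_sqrt// ler1n.
move=> xa xb /le_trans; apply.
rewrite -lerBrDr.
have z0 : 0 <= 80 * c * nu - 5 * c - c.
  rewrite (_ : _ - _ = c * (80 * nu - 6)); last by ring.
  by rewrite mulr_ge0//; lra.
apply: sqr_le => //.
rewrite sqr_sqrtr ?addr_ge0 ?sqr_ge0//.
clearbody al be nu.
have xa2 : x a ^+ 2 <= (80 * c * al - 5 * c) ^+ 2.
  by rewrite ler_pXn2r// ?nnegrE// (le_trans _ xa).
have xb2 : x b ^+ 2 <= (80 * c * be - 5 * c) ^+ 2.
  by rewrite ler_pXn2r// ?nnegrE// (le_trans _ xb).
apply: (le_trans (lerD xa2 xb2)).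
have c2 : 0 <= c ^+ 2 by exact: sqr_ge0.
(* The quadratic terms cancel since [nu^2 = al^2 + be^2]. As [al + be >= 127/100 nu], the rest is at
   least [1016 nu - 960 nu - 14], which is nonnegative for [nu >= 1]; the constant [5] was chosen so
   that [5 * 127/100 > 5 + 1]. *)
rewrite -subr_ge0 [X in 0 <= X](_ : _ = c ^+ 2 *
  (6400 * (nu ^+ 2 - (al ^+ 2 + be ^+ 2)) + 800 * (al + be) - 960 * nu - 14)).
  apply: mulr_ge0 c2 _.
  rewrite nuE subrr mulr0 add0r.
  move: al_nu be_nu nu1; clear.
  lra.
by clear; ring.
Qed.

(** Letting [m] tend to infinity in the Cauchy estimate preserves the rate [delta n]. It serves both
    the means divided by [n] and the norms divided by [sqrt n]. *)
Lemma cvg_of_dist_le (R : realType) (r delta : nat -> R) :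
  delta n @[n --> \oo] --> 0 ->
  (forall n m, (0 < n)%N -> (0 < m)%N -> `|r n - r m| <= delta n + delta m) ->
  exists s : R, r n @[n --> \oo] --> s /\
    forall n, (0 < n)%N -> `|r n - s| <= delta n.
Proof.
move=> d0 rd.
have /cauchy_cvgP/cvg_ex[s rs] : cauchy (r n @[n --> \oo]).
  apply: cauchy_exP => e e0; have e2 : 0 < e / 2 by rewrite divr_gt0.
  have dn : \forall n \near \oo, delta n < e / 2.
    have /cvgrPdist_lt/(_ _ e2) := d0; apply: filterS => n.
    by rewrite sub0r normrN; exact: le_lt_trans (ler_norm _).
  near \oo => m; exists (r m).
  change (\forall n \near \oo, `|r m - r n| < e); near=> n.
  rewrite (le_lt_trans (rd _ _ _ _))//.
  - by near: m; exact: nbhs_infty_gt.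
  - by near: n; exact: nbhs_infty_gt.
  - rewrite [ltRHS]splitr ltrD//; [near: m|near: n]; exact: dn.
exists s; split=> // n n0.
have h1 : `|r n - r m| @[m --> \oo] --> `|r n - s|.
  by apply: cvg_norm; apply: cvgB => //; exact: cvg_cst.
have h2 : delta n + delta m @[m --> \oo] --> delta n.
  by rewrite -[X in _ --> X]addr0; apply: cvgD => //; exact: cvg_cst.
apply: (ler_cvg_to h1 h2); near=> m; apply: rd => //.
by near: m; exact: nbhs_infty_gt.
Unshelve. all: by end_near. Qed.

Section block_decomposition.
Context d (G : measurableType d) (R : realType) (mu : probability G R).
Local Notation Om := (seqspace G).
Local Notation P := (product_measure mu).
Variables (q : nat -> Om -> R) (c : R).
Hypothesis q0 : forall w, q 0%N w = 0.
Hypothesis q_prefix : forall n, prefix_determined n (q n).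
Hypothesis q2 : forall n, square_integrable P (q n).
Hypothesis q_mean : forall n, mean P (q n) = 0.
Hypothesis c0 : 0 <= c.
Hypothesis q_defect : forall n m,
  norm2 P (fun w => q (n + m)%N w - q n w - q m (shift n w)) <= c.

Definition block_sum m N (w : Om) : R := \sum_(j < N) q m (shift (j * m) w).

Lemma shift_shift (n k : nat) (w : Om) : shift n (shift k w) = shift (k + n) w.
Proof. by apply/funext => i; rewrite /Defs.shift addnA. Qed.

Lemma block_sumD m a b w :
  block_sum m (a + b) w = block_sum m a w + block_sum m b (shift (a * m) w).
Proof.
rewrite /block_sum big_split_ord /=; congr (_ + _).
by apply: eq_bigr => j _; rewrite shift_shift mulnDl.
Qed.

Lemma block_sum1 m w : block_sum m 1 w = q m w.
Proof. by rewrite /block_sum big_ord1. Qed.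

Lemma block_sumS m N w :
  block_sum m N.+1 w = block_sum m N w + q m (shift (N * m) w).
Proof. by rewrite -addn1 block_sumD block_sum1. Qed.

Lemma agree_shift n k (w w' : Om) :
  agree (n + k) w w' -> agree k (shift n w) (shift n w').
Proof. by move=> ag i ik; rewrite /Defs.shift ag// ltn_add2l. Qed.

Lemma agreeW n k (w w' : Om) : (k <= n)%N -> agree n w w' -> agree k w w'.
Proof. by move=> kn ag i ik; apply: ag; exact: leq_trans kn. Qed.

Lemma block_sum_prefix m N : prefix_determined (N * m) (block_sum m N).
Proof.
move=> w w' ag; apply: eq_bigr => j _; apply: q_prefix; apply: agree_shift.
by apply: agreeW ag; rewrite addnC -mulSn leq_mul2r ltn_ord orbT.
Qed.

Lemma block_sum_square_integrable m N : square_integrable P (block_sum m N).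
Proof.
elim: N => [|N IH].
  have -> : block_sum m 0 = fun=> 0.
    by apply/funext => w; rewrite /block_sum big_ord0.
  exact: square_integrable_cst.
have -> : block_sum m N.+1 = (fun w => block_sum m N w + q m (shift (N * m) w)).
  by apply/funext => w; exact: block_sumS.
by apply: square_integrableD => //; exact: square_integrable_shift.
Qed.

Lemma block_sum_mean m N : mean P (block_sum m N) = 0.
Proof.
elim: N => [|N IH].
  have -> : block_sum m 0 = fun=> 0.
    by apply/funext => w; rewrite /block_sum big_ord0.
  exact: mean_cst.
have -> : block_sum m N.+1 = (fun w => block_sum m N w + q m (shift (N * m) w)).
  by apply/funext => w; exact: block_sumS.
have iq := square_integrable_integrableR (q2 m).
rewrite meanD; last exact: integrableR_shift.
  by rewrite IH mean_shift// q_mean addr0.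
exact/square_integrable_integrableR/block_sum_square_integrable.
Qed.

(** The blocks are independent, centered and of equal norm, so their squared norms add up. *)
Lemma block_sum_norm2 m N :
  norm2 P (block_sum m N) = Num.sqrt N%:R * norm2 P (q m).
Proof.
have H : norm2 P (block_sum m N) ^+ 2 = N%:R * norm2 P (q m) ^+ 2.
  elim: N => [|N IH].
    have -> : block_sum m 0 = fun=> 0.
      by apply/funext => w; rewrite /block_sum big_ord0.
    by rewrite norm2_cst normr0 expr0n mul0r.
  have -> : block_sum m N.+1 = (fun w => block_sum m N w + q m (shift (N * m) w)).
    by apply/funext => w; exact: block_sumS.
  rewrite norm2D_shift//.
  - by rewrite IH -natr1; ring.
  - exact: block_sum_prefix.
  - exact: block_sum_square_integrable.
  - exact: block_sum_mean.
rewrite -[LHS]ger0_norm ?norm2_ge0// -sqrtr_sqr H sqrtrM ?ler0n//.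
by rewrite sqrtr_sqr ger0_norm ?norm2_ge0.
Qed.

Definition block_error m N (w : Om) : R := q (N * m) w - block_sum m N w.

Lemma block_error_square_integrable m N :
  square_integrable P (block_error m N).
Proof. by apply: square_integrableB => //; exact: block_sum_square_integrable. Qed.

(** The error over [a + b] blocks is the error over the first [a], plus the shifted error over the
    last [b], plus one defect. The first two are orthogonal, which is the recursion of
    [sqrt_subadditive_growth]; the resulting constant is independent of [m]. *)
Lemma block_error_norm2 m N : (0 < N)%N ->
  norm2 P (block_error m N) <= 80 * c * Num.sqrt N%:R.
Proof.
move: N; apply: (sqrt_subadditive_growth c0).
- by move=> n; exact: norm2_ge0.
- have -> : block_error m 1 = fun=> 0.
    by apply/funext => w; rewrite /block_error block_sum1 mul1n subrr.
  by rewrite norm2_cst normr0.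
move=> a b _ _.
have sa := block_error_square_integrable m a.
have sb := block_error_square_integrable m b.
have sab : square_integrable P
    (fun w => block_error m a w + block_error m b (shift (a * m) w)).
  by apply: square_integrableD => //; exact: square_integrable_shift.
have sdef : square_integrable P (fun w => q (a * m + b * m)%N w - q (a * m)%N w -
    q (b * m)%N (shift (a * m) w)).
  apply: square_integrableB; last exact: square_integrable_shift.
  exact: square_integrableB.
have -> : block_error m (a + b) = fun w =>
    (block_error m a w + block_error m b (shift (a * m) w)) +
    (q (a * m + b * m)%N w - q (a * m)%N w - q (b * m)%N (shift (a * m) w)).
  by apply/funext => w; rewrite /block_error block_sumD mulnDl; ring.
apply: (le_trans (norm2D sab sdef)); rewrite lerD//.
rewrite -[leLHS]ger0_norm ?norm2_ge0// -sqrtr_sqr norm2D_shift//.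
- move=> w w' ag; rewrite /block_error (q_prefix ag).
  by rewrite (block_sum_prefix ag).
- rewrite meanB ?q_mean ?block_sum_mean ?subrr//.
  + exact/square_integrable_integrableR.
  + exact/square_integrable_integrableR/block_sum_square_integrable.
Qed.

Lemma norm2_block_mul m N : (0 < N)%N ->
  `|norm2 P (q (N * m)) - Num.sqrt N%:R * norm2 P (q m)| <=
  80 * c * Num.sqrt N%:R.
Proof.
move=> N0; rewrite -block_sum_norm2.
apply: le_trans (block_error_norm2 m N0).
by apply: ler_dist_norm2 => //; exact: block_sum_square_integrable.
Qed.

(** Blocks of length one. This provides the uniform second moments and controls incomplete
    blocks. *)
Lemma norm2_le_sqrt n :
  norm2 P (q n) <= (80 * c + norm2 P (q 1)) * Num.sqrt n%:R.
Proof.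
case: n => [|n].
  have -> : q 0%N = fun=> 0 by apply/funext => w; exact: q0.
  by rewrite norm2_cst normr0 sqrtr0 mulr0.
have := norm2_block_mul 1 (ltn0Sn n); rewrite muln1.
by rewrite ler_distl => /andP[_]; rewrite mulrC; lra.
Qed.

Let r n : R := norm2 P (q n) / Num.sqrt n%:R.

(* Both [r n] and [r m] are compared with [r (n * m)]. *)
Lemma normalized_norm2_dist n m : (0 < n)%N -> (0 < m)%N ->
  `|r n - r m| <= 80 * c * ((Num.sqrt n%:R)^-1 + (Num.sqrt m%:R)^-1).
Proof.
move=> n0 m0.
have H a b : (0 < a)%N -> (0 < b)%N ->
    `|r (a * b) - r b| <= 80 * c * (Num.sqrt b%:R)^-1.
  move=> a0 b0; have := norm2_block_mul b a0.
  have sa : 0 < Num.sqrt a%:R :> R by rewrite sqrtr_gt0 ltr0n.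
  have sb : 0 < Num.sqrt b%:R :> R by rewrite sqrtr_gt0 ltr0n.
  rewrite /r natrM sqrtrM ?ler0n//.
  set x := norm2 P (q (a * b)%N); set y := norm2 P (q b) => h.
  have -> : x / (Num.sqrt a%:R * Num.sqrt b%:R) - y / Num.sqrt b%:R =
      (Num.sqrt a%:R * Num.sqrt b%:R)^-1 * (x - Num.sqrt a%:R * y).
    by field; rewrite !gt_eqF.
  rewrite normrM ger0_norm ?invr_ge0 ?mulr_ge0 ?sqrtr_ge0//.
  rewrite ler_pdivrMl ?mulr_gt0//; apply: (le_trans h).
  by rewrite le_eqVlt; apply/orP; left; apply/eqP; field; rewrite gt_eqF.
have h1 := H m n m0 n0; have h2 := H n m n0 m0.
rewrite (_ : r n - r m = (r (n * m)%N - r m) - (r (m * n)%N - r n)).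
  by rewrite (le_trans (ler_normB _ _))// mulrDr addrC lerD.
by rewrite (mulnC m n); ring.
Qed.

(** Each block replaced by its Gaussian factor costs one [char_error]. The phase [b] stays fixed in
    the induction: the sine of the partial sum need only be bounded by [1], because it is multiplied
    by the sine mean of a single block. *)
Lemma mean_cos_block_sum (m N : nat) (s b : R) :
  `|mean P (fun w => cos (s * block_sum m N w + b)) -
    expR (- (N%:R * (s ^+ 2 * norm2 P (q m) ^+ 2 / 2))) * cos b| <=
  N%:R * char_error mu (q m) s.
Proof.
set k := s ^+ 2 * norm2 P (q m) ^+ 2 / 2.
have k0 : 0 <= k by rewrite divr_ge0// mulr_ge0 ?sqr_ge0.
elim: N => [|N IH].
  rewrite (eq_mean _ (g := fun=> cos b)).
    by rewrite mean_cst !mul0r oppr0 expR0 mul1r subrr normr0.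
  by move=> w; rewrite /block_sum big_ord0 mulr0 add0r.
have [mS _] := block_sum_square_integrable m N.
have [mY _] := q2 m.
have ic := integrableR_cos mu s b mS; have is_ := integrableR_sin mu s b mS.
have ic' : integrableR P (fun w => cos (s * q m w)).
  have := integrableR_cos mu s 0 mY; congr integrableR; apply/funext => w.
  by rewrite addr0.
have is' : integrableR P (fun w => sin (s * q m w)).
  have := integrableR_sin mu s 0 mY; congr integrableR; apply/funext => w.
  by rewrite addr0.
have pS : prefix_determined (N * m) (block_sum m N) := @block_sum_prefix m N.
have pc : prefix_determined (N * m) (fun w => cos (s * block_sum m N w + b)).
  by move=> w w' /pS ->.
have ps : prefix_determined (N * m) (fun w => sin (s * block_sum m N w + b)).
  by move=> w w' /pS ->.
have [icc ecc] := meanM_shift pc ic ic'.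
have [iss ess] := meanM_shift ps is_ is'.
rewrite (eq_mean _ (g := fun w =>
  cos (s * block_sum m N w + b) * cos (s * q m (shift (N * m) w)) -
  sin (s * block_sum m N w + b) * sin (s * q m (shift (N * m) w)))); last first.
  move=> w; rewrite block_sumS -cosD; congr cos; ring.
rewrite meanB// ecc ess.
set A := mean P (fun w => cos (s * block_sum m N w + b)) in IH *.
set B := mean P (fun w => sin (s * block_sum m N w + b)).
set C := mean P (fun w => cos (s * q m w)).
set D := mean P (fun w => sin (s * q m w)).
have A1 : `|A| <= 1.
  apply: (le_trans (le_norm_mean ic)); rewrite -[leRHS](mean_cst P).
  apply: le_mean; [exact: integrableR_norm|exact: integrableR_cst|].
  by move=> w; exact: cos_max.
have B1 : `|B| <= 1.
  apply: (le_trans (le_norm_mean is_)); rewrite -[leRHS](mean_cst P).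
  apply: le_mean; [exact: integrableR_norm|exact: integrableR_cst|].
  by move=> w; exact: sin_max.
have -> : expR (- (N.+1%:R * k)) = expR (- (N%:R * k)) * expR (- k).
  by rewrite -expRD -natr1; congr expR; ring.
have e1 : expR (- k) <= 1 by rewrite -expR0 ler_expR oppr_le0.
have e0 := expR_ge0 (- k).
(* The first two terms are the error of the last block; the third is the inductive error, damped by
   a factor at most [1]. *)
rewrite (_ : _ - _ = A * (C - expR (- k)) - B * D +
  expR (- k) * (A - expR (- (N%:R * k)) * cos b)); last by ring.
apply: (le_trans (ler_normD _ _)); rewrite -natr1 mulrDl mul1r addrC lerD//.
  rewrite normrM (ger0_norm e0); apply: le_trans IH.
  by rewrite ler_piMl.
apply: (le_trans (ler_normB _ _)); rewrite /char_error -/k -/C -/D !normrM lerD//.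
  by rewrite ler_piMl.
by rewrite ler_piMl.
Qed.

(** Euclidean division leaves three errors: that of the complete blocks, the incomplete block and
    one defect. The last two depend on [m] only and vanish once divided by [sqrt n]. *)
Lemma block_sum_remainder m n : (0 < m)%N -> (m <= n)%N ->
  norm2 P (fun w => q n w - block_sum m (n %/ m) w) <=
  80 * c * Num.sqrt (n %/ m)%:R +
  ((80 * c + norm2 P (q 1)) * Num.sqrt m%:R + c).
Proof.
move=> m0 mn; set N := (n %/ m)%N; set k := (n %% m)%N.
have nE : n = (N * m + k)%N by exact: divn_eq.
have N0 : (0 < N)%N by rewrite divn_gt0.
have km : (k <= m)%N by rewrite ltnW// ltn_pmod.
have se := block_error_square_integrable m N.
have sk := square_integrable_shift (N * m) (q2 k).
have sd : square_integrable P
    (fun w => q (N * m + k)%N w - q (N * m)%N w - q k (shift (N * m) w)).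
  by apply: square_integrableB => //; exact: square_integrableB.
have -> : (fun w => q n w - block_sum m N w) = (fun w => block_error m N w +
    (q k (shift (N * m) w) +
    (q (N * m + k)%N w - q (N * m)%N w - q k (shift (N * m) w)))).
  by apply/funext => w; rewrite /block_error -nE; ring.
apply: (le_trans (norm2D se (square_integrableD sk sd))); apply: lerD.
  exact: block_error_norm2.
apply: (le_trans (norm2D sk sd)); apply: lerD; last exact: q_defect.
rewrite norm2_shift//.
apply: (le_trans (norm2_le_sqrt k)).
rewrite ler_wpM2l ?ler_wsqrtr ?ler_nat//.
by rewrite addr_ge0 ?norm2_ge0// mulr_ge0.
Qed.

(** The order of the limits matters: [m] is fixed first, to make small the errors that do not
    decrease with [n] (block error and [r m ^ 2 - sigma ^ 2]), and then [n] tends to infinity. *)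
Lemma cvg_mean_cos (sigma t b : R) :
  norm2 P (q n) / Num.sqrt n%:R @[n --> \oo] --> sigma ->
  mean P (fun w => cos (t / Num.sqrt n%:R * q n w + b)) @[n --> \oo] -->
  expR (- (sigma ^+ 2 * t ^+ 2 / 2)) * cos b.
Proof.
move=> rs; apply/cvgrPdist_le => /= e0 e0_gt0.
(* Five errors: complete blocks, remainder, Gaussian replacement, [r m ^ 2] against [sigma ^ 2], and
   [N m] against [n]. *)
pose e := e0 / 5; have e_gt0 : 0 < e by rewrite divr_gt0.
have r2s : t ^+ 2 / 2 * `|r m ^+ 2 - sigma ^+ 2| @[m --> \oo] --> 0.
  rewrite -[X in _ --> X](mulr0 (t ^+ 2 / 2)); apply: cvgM; first exact: cvg_cst.
  rewrite -(normr0 R); apply: cvg_norm; rewrite -[X in _ --> X](subrr (sigma ^+ 2)).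
  by apply: cvgB; [apply: cvgM|exact: cvg_cst].
have cs : `|t| * (80 * c) * (Num.sqrt m%:R)^-1 @[m --> \oo] --> 0.
  rewrite -[X in _ --> X](mulr0 (`|t| * (80 * c))); apply: cvgM.
    exact: cvg_cst.
  exact: cvg_sqrt_natV.
have small (u : nat -> R) : u n @[n --> \oo] --> 0 -> \forall n \near \oo, u n <= e.
  move=> /cvgrPdist_le/(_ _ e_gt0); apply: filterS => n.
  by rewrite sub0r normrN; exact: le_trans (ler_norm _).
have [m [m0 hm1 hm2]] : exists m, [/\ (0 < m)%N,
    t ^+ 2 / 2 * `|r m ^+ 2 - sigma ^+ 2| <= e &
    `|t| * (80 * c) * (Num.sqrt m%:R)^-1 <= e].
  near \oo => m; exists m; split.
  - by near: m; exact: nbhs_infty_gt.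
  - by near: m; exact: small.
  - by near: m; exact: small.
pose K := (80 * c + norm2 P (q 1)) * Num.sqrt m%:R + c.
near=> n.
have n0 : (0 < n)%N by near: n; exact: nbhs_infty_gt.
have mn : (m <= n)%N by near: n; exact: nbhs_infty_ge.
set N := (n %/ m)%N; set s := t / Num.sqrt n%:R.
have nR : 0 < n%:R :> R by rewrite ltr0n.
have mR : 0 < m%:R :> R by rewrite ltr0n.
have sn : 0 < Num.sqrt n%:R :> R by rewrite sqrtr_gt0.
have sm : 0 < Num.sqrt m%:R :> R by rewrite sqrtr_gt0.
have snE : Num.sqrt n%:R ^+ 2 = n%:R :> R by rewrite sqr_sqrtr// ltW.
have smE : Num.sqrt m%:R ^+ 2 = m%:R :> R by rewrite sqr_sqrtr// ltW.
have Nmn : (N * m <= n)%N by exact: leq_trunc_div.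
have nNm : (n <= N * m + m)%N.
  by rewrite {1}(divn_eq n m) leq_add2l ltnW// ltn_pmod.
have NmnR : N%:R * m%:R <= n%:R :> R by rewrite -natrM ler_nat.
have nNmR : n%:R <= N%:R * m%:R + m%:R :> R by rewrite -natrM -natrD ler_nat.
have rem := block_sum_remainder m0 mn; rewrite -/N -/K in rem.
have sS := block_sum_square_integrable m N.
have h1 : `|mean P (fun w => cos (s * q n w + b)) -
    mean P (fun w => cos (s * block_sum m N w + b))| <= e + e.
  apply: (le_trans (mean_cos_dist s b (q2 n) sS)).
  have : `|s| * norm2 P (fun w => q n w - block_sum m N w) <=
      `|s| * (80 * c * Num.sqrt N%:R + K) by rewrite ler_wpM2l.
  move=> /le_trans; apply; rewrite mulrDr lerD//.
    apply: le_trans hm2.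
    have NmV : Num.sqrt N%:R <= Num.sqrt n%:R / Num.sqrt m%:R :> R.
      by rewrite ler_pdivlMr// -sqrtrM ?ler0n// ler_wsqrtr.
    rewrite /s normrM normfV (gtr0_norm sn).
    rewrite (_ : _ * _ = `|t| * (80 * c) * (Num.sqrt N%:R / Num.sqrt n%:R)).
      by rewrite ler_wpM2l ?mulr_ge0// ler_pdivrMr// mulrC.
    by ring.
  have : `|t| * K * (Num.sqrt n%:R)^-1 <= e.
    near: n; apply: small; rewrite -[X in _ --> X](mulr0 (`|t| * K)); apply: cvgM.
      exact: cvg_cst.
    exact: cvg_sqrt_natV.
  by rewrite /s normrM normfV (gtr0_norm sn) mulrAC.
have h2 : N%:R * char_error mu (q m) s <= e.
  apply: (@le_trans _ _ (n%:R * char_error mu (q m) s)).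
    by rewrite ler_wpM2r ?addr_ge0// ler_nat leq_div.
  rewrite /s; near: n.
  apply: (small (fun n => n%:R * char_error mu (q m) (t / Num.sqrt n%:R))).
  exact: cvg_char_error.
have h3 := mean_cos_block_sum m N s b.
have h4 : `|expR (- (N%:R * (s ^+ 2 * norm2 P (q m) ^+ 2 / 2))) -
    expR (- (sigma ^+ 2 * t ^+ 2 / 2))| <= e + e.
  apply: (le_trans (expRN_dist_le _ _)).
  - by rewrite mulr_ge0 ?ler0n// divr_ge0// mulr_ge0 ?sqr_ge0.
  - by rewrite divr_ge0// mulr_ge0 ?sqr_ge0.
  (* The exponent is [t^2 / 2 * r m ^ 2 * (N m / n)], and [N m / n] differs from [1] by at most
     [m / n]. *)
  have -> : N%:R * (s ^+ 2 * norm2 P (q m) ^+ 2 / 2) - sigma ^+ 2 * t ^+ 2 / 2 =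
     t ^+ 2 / 2 * (r m ^+ 2 - sigma ^+ 2) -
     t ^+ 2 / 2 * r m ^+ 2 * ((n%:R - N%:R * m%:R) / n%:R).
    have sn0 := lt0r_neq0 sn; have sm0 := lt0r_neq0 sm.
    rewrite /s /r; move: snE smE sn0 sm0.
    move: (Num.sqrt n%:R) (Num.sqrt m%:R) => y z <- <- y0 z0; field.
    by rewrite y0 z0.
  apply: (le_trans (ler_normB _ _)); rewrite lerD//.
    by rewrite normrM ger0_norm// divr_ge0// sqr_ge0.
  have t2 : 0 <= t ^+ 2 / 2 * r m ^+ 2 by rewrite mulr_ge0 ?sqr_ge0// divr_ge0// sqr_ge0.
  rewrite normrM (ger0_norm t2) ger0_norm; last first.
    by rewrite divr_ge0 ?subr_ge0// ltW.
  apply: (@le_trans _ _ (t ^+ 2 / 2 * r m ^+ 2 * m%:R * n%:R^-1)).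
    by rewrite -[leRHS]mulrA ler_wpM2l// ler_wpM2r ?invr_ge0 ?ler0n//; lra.
  near: n; apply: small.
  rewrite -[X in _ --> X](mulr0 (t ^+ 2 / 2 * r m ^+ 2 * m%:R)); apply: cvgM.
    exact: cvg_cst.
  exact: cvg_natV.
have h5 : `|expR (- (N%:R * (s ^+ 2 * norm2 P (q m) ^+ 2 / 2))) * cos b -
    expR (- (sigma ^+ 2 * t ^+ 2 / 2)) * cos b| <= e + e.
  rewrite -mulrBl normrM; apply: le_trans h4.
  by rewrite ler_piMr// cos_max.
have -> : e0 = e + e + e + (e + e) by rewrite /e; field.
move: h1 h2 h3 h5.
set A := mean P _; set B := mean P _; set C := expR _ * _; set D := expR _ * _.
rewrite !ler_norml => /andP[? ?] ? /andP[? ?] /andP[? ?].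
by apply/andP; split; lra.
Unshelve. all: by end_near. Qed.

End block_decomposition.

(** * Gaussian characteristic function *)

Section gaussian.
Context (R : realType).
Local Notation leb := (@lebesgue_measure R).

(** The fundamental theorem on [[-n, n]], with dominated convergence on one side and vanishing
    boundary terms on the other. *)
Lemma integral_derive_vanishing (g dg : R -> R) :
  (forall x : R, is_derive x (1 : R) g (dg x)) -> continuous dg ->
  leb.-integrable setT (EFin \o dg) ->
  g n%:R @[n --> \oo] --> 0 -> g (- n%:R) @[n --> \oo] --> 0 ->
  \int[leb]_x dg x = 0.
Proof.
move=> gdg cdg idg gy gNy.
pose I (n : nat) : set R := `[(- n%:R), n%:R]%classic.
have mI n : measurable (I n : set (measurableTypeR R)) by exact: measurable_itv.
have mdg : measurable_fun setT dg by exact: continuous_measurable_fun.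
have cvg1 : (\int[leb]_x (((EFin \o dg) \_ (I n)) x))%E @[n --> \oo] -->
    (\int[leb]_x (dg x)%:E)%E.
  apply: (@dominated_cvg _ _ _ leb _ measurableT _ _
    (fun x => `|dg x|%:E)) => //.
  - move=> n; apply/(measurable_restrictT _ (mI n)).
    exact/measurable_funTS/measurable_EFinP.
  - move=> x _; apply: cvg_near_cst; near=> n.
    rewrite patchE mem_set// /I /= in_itv /= -ler_norml.
    near: n; exact: nbhs_infty_ger.
  - exact: (integrable_norm idg).
  - move=> n x _; rewrite patchE; case: ifP => _; first by rewrite lee_fin.
    by rewrite abse0 lee_fin.
have cvg2 : (\int[leb]_x (((EFin \o dg) \_ (I n)) x))%E @[n --> \oo] --> 0%E.
  have : (g n%:R - g (- n%:R))%:E @[n --> \oo] --> (0 - 0 : R)%:E.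
    by apply: cvg_EFin; [exact: nearW|exact: cvgB].
  rewrite subr0; apply: cvg_trans; apply: near_eq_cvg; near=> n.
  have n0 : (0 < n%:R :> R) by rewrite ltr0n; near: n; exact: nbhs_infty_gt.
  rewrite -integral_mkcond; apply/esym.
  apply: (@continuous_FTC2 _ dg g) => //.
  - by apply: (lt_trans _ n0); rewrite oppr_lt0.
  - by apply: continuous_subspaceT => x; exact: cdg.
  - have cg x : {for x, continuous g}.
      by apply/differentiable_continuous/derivable1_diffP.
    split.
    + by move=> x _.
    + by apply: cvg_at_right_filter; exact: cg.
    + by apply: cvg_at_left_filter; exact: cg.
  - by move=> x _; rewrite derive1E; exact: derive_val.
by rewrite /Rintegral (cvg_unique _ cvg1 cvg2).
Unshelve. all: by end_near. Qed.

Variable s : R.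
Hypothesis s0 : s != 0.
Local Notation p := (normal_pdf 0 s).

Lemma normal_pdf0_sqrE x :
  p x = normal_peak s * expR (- (x ^+ 2 / (2 * s ^+ 2))).
Proof.
by rewrite normal_pdfE// /normal_fun subr0 mulNr mulr_natl.
Qed.

Lemma is_derive_normal_pdf0 (x : R) : is_derive x (1 : R) p (- (x / s ^+ 2) * p x).
Proof.
have -> : p = (fun x => normal_peak s * expR (- (x ^+ 2 / (2 * s ^+ 2)))).
  by apply/funext => y; exact: normal_pdf0_sqrE.
apply: trigger_derive.
rewrite /GRing.scale /=.
by field.
Qed.

(** With [y = x^2 / (4 s^2)] the density is proportional to [exp (-2 y)]; since [y exp (-y) <= 1],
    one factor [exp (-y)] absorbs [x^2], and the other one is the Gaussian profile of standard
    deviation [sqrt 2 * s]. *)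
Lemma sqr_normal_pdf0_le x : x ^+ 2 * p x <=
  4 * s ^+ 2 * (normal_peak s / normal_peak (Num.sqrt 2 * s)) *
  normal_pdf 0 (Num.sqrt 2 * s) x.
Proof.
have s2 : 0 < s ^+ 2 by rewrite lt0r sqr_ge0 sqrf_eq0 s0.
have s20 : Num.sqrt 2 * s != 0 by rewrite mulf_neq0// sqrtr_eq0 -ltNge.
have pk := normal_peak_gt0 s20; have pk' := normal_peak_gt0 s0.
rewrite normal_pdf0_sqrE normal_pdfE// /normal_fun subr0 exprMn sqr_sqrtr//.
set y := x ^+ 2 / (4 * s ^+ 2).
have -> : - x ^+ 2 / (2 * s ^+ 2 *+ 2) = - y.
  by rewrite /y mulNr; congr (- (_ / _)); rewrite -mulr_natr; ring.
have -> : x ^+ 2 / (2 * s ^+ 2) = y + y by rewrite /y; field.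
have -> : x ^+ 2 = 4 * s ^+ 2 * y by rewrite /y; field.
rewrite opprD expRD.
have -> : 4 * s ^+ 2 * (normal_peak s / normal_peak (Num.sqrt 2 * s)) *
   (normal_peak (Num.sqrt 2 * s) * expR (- y)) =
   4 * s ^+ 2 * normal_peak s * expR (- y) * 1.
  by field; rewrite gt_eqF.
have -> : 4 * s ^+ 2 * y * (normal_peak s * (expR (- y) * expR (- y))) =
   4 * s ^+ 2 * normal_peak s * expR (- y) * (y * expR (- y)) by ring.
have C0 : 0 < 4 * s ^+ 2 * normal_peak s * expR (- y).
  by rewrite pmulr_rgt0 ?expR_gt0// pmulr_rgt0// pmulr_rgt0.
rewrite ler_pM2l//.
rewrite expRN ler_pdivrMr ?expR_gt0// mul1r.
by apply: le_trans (expR_ge1Dx _); rewrite lerDr.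
Qed.

Lemma integrable_sqr_normal_pdf0 :
  leb.-integrable setT (fun x => (x ^+ 2 * p x)%:E).
Proof.
set C := 4 * s ^+ 2 * (normal_peak s / normal_peak (Num.sqrt 2 * s)).
have := integrableZl measurableT C (integrable_normal_pdf 0 (Num.sqrt 2 * s)).
apply: le_integrable => //.
  apply/measurable_EFinP/measurable_funM; first exact: measurable_funX.
  exact: measurable_normal_pdf.
move=> x _ /=; rewrite lee_fin !ger0_norm ?sqr_normal_pdf0_le//.
  by rewrite (le_trans _ (sqr_normal_pdf0_le x))// mulr_ge0 ?sqr_ge0 ?normal_pdf_ge0.
by rewrite mulr_ge0 ?sqr_ge0 ?normal_pdf_ge0.
Qed.

(** For [x = e n] with [n >= 1], [n p x <= x^2 p x], which is bounded. The sign [e] treats both ends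
    of the line. *)
Lemma cvg_normal_pdf0 (e : R) : `|e| = 1 ->
  p (e * n%:R) @[n --> \oo] --> 0.
Proof.
move=> e1; set C := 4 * s ^+ 2 * (normal_peak s / normal_peak (Num.sqrt 2 * s)).
have s20 : Num.sqrt 2 * s != 0 by rewrite mulf_neq0// sqrtr_eq0 -ltNge.
apply: (@squeeze_cvgr _ _ _ _ (cst 0)
  (fun n => C * normal_peak (Num.sqrt 2 * s) * n%:R^-1)); last 2 first.
- exact: cvg_cst.
- rewrite -(mulr0 (C * normal_peak (Num.sqrt 2 * s))).
  apply: cvgM; first exact: cvg_cst.
  exact: cvg_natV.
near=> n; rewrite normal_pdf_ge0 /=.
have n0 : (0 < n%:R :> R) by rewrite ltr0n; near: n; exact: nbhs_infty_gt.
have n1 : (1 <= n%:R :> R) by rewrite ler1n; near: n; exact: nbhs_infty_gt.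
rewrite ler_pdivlMr//.
have e2 : (e * n%:R) ^+ 2 = n%:R ^+ 2 :> R.
  by rewrite exprMn -(real_normK (num_real e)) e1 expr1n mul1r.
apply: (@le_trans _ _ ((e * n%:R) ^+ 2 * p (e * n%:R))).
  by rewrite e2 mulrC ler_wpM2r ?normal_pdf_ge0// ler_eXnr.
apply: (le_trans (sqr_normal_pdf0_le _)).
rewrite ler_wpM2l ?normal_pdf_ub//.
by apply: mulr_ge0; [rewrite mulr_ge0 ?sqr_ge0|rewrite divr_ge0 ?normal_peak_ge0].
Unshelve. all: by end_near. Qed.

Lemma measurable_cos_affine (t b : R) :
  measurable_fun [set: R] (fun x => cos (t * x + b)).
Proof.
apply: (measurableT_comp (continuous_measurable_fun (@continuous_cos R))).
by apply: measurable_funD => //; exact: measurable_funM.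
Qed.

Lemma integrable_cos_normal_pdf0 (t b : R) :
  leb.-integrable setT (EFin \o (fun x => p x * cos (t * x + b))).
Proof.
have := integrable_normal_pdf 0 s; apply: le_integrable => //.
  apply/measurable_EFinP/measurable_funM; first exact: measurable_normal_pdf.
  exact: measurable_cos_affine.
move=> x _ /=; rewrite lee_fin normrM ler_piMr//.
exact: cos_max.
Qed.

Lemma norm_mul_normal_pdf0_le x : `|x * p x| <= p x + x ^+ 2 * p x.
Proof.
have p0 := normal_pdf_ge0 0 s x.
have hp : 0 <= p x * (1 + x ^+ 2 + x) by apply: mulr_ge0 => //; nra.
have hm : 0 <= p x * (1 + x ^+ 2 - x) by apply: mulr_ge0 => //; nra.
by rewrite ler_norml; apply/andP; split; lra.
Qed.

Lemma integrable_mul_normal_pdf0 (h : R -> R) : measurable_fun setT h ->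
  (forall x, `|h x| <= 1) ->
  leb.-integrable setT (EFin \o (fun x => x * p x * h x)).
Proof.
move=> mh h1.
have := integrableD measurableT (integrable_normal_pdf 0 s)
  integrable_sqr_normal_pdf0.
apply: le_integrable => //.
  apply/measurable_EFinP; apply: measurable_funM => //.
  by apply: measurable_funM => //; exact: measurable_normal_pdf.
move=> x _ /=; rewrite lee_fin.
rewrite [leRHS]ger0_norm.
  apply: (le_trans _ (norm_mul_normal_pdf0_le x)).
  by rewrite normrM ler_piMr.
by rewrite addr_ge0 ?normal_pdf_ge0// mulr_ge0 ?sqr_ge0 ?normal_pdf_ge0.
Qed.

(** Gaussian integration by parts: the derivative of [p x * sin (t x + b)] has integral zero, and
    [p' = - (x / s^2) p]. *)
Lemma mul_sin_normal_pdf0 (t b : R) :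
  \int[leb]_x (x * p x * sin (t * x + b)) =
  s ^+ 2 * t * \int[leb]_x (p x * cos (t * x + b)).
Proof.
pose g x := p x * sin (t * x + b).
pose dg x := t * (p x * cos (t * x + b)) - (s ^+ 2)^-1 * (x * p x * sin (t * x + b)).
have msin : measurable_fun [set: R] (fun x => sin (t * x + b)).
  apply: (measurableT_comp (continuous_measurable_fun (@continuous_sin R))).
  by apply: measurable_funD => //; exact: measurable_funM.
have i1 := integrable_cos_normal_pdf0 t b.
have i2 := integrable_mul_normal_pdf0 msin (fun x => sin_max _).
have i1' : leb.-integrable setT (EFin \o (fun x => t * (p x * cos (t * x + b)))).
  exact: (integrableZl measurableT t i1).
have i2' : leb.-integrable setT
    (EFin \o (fun x => (s ^+ 2)^-1 * (x * p x * sin (t * x + b)))).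
  exact: (integrableZl measurableT _ i2).
have gdg (x : R) : is_derive x (1 : R) g (dg x).
  have := is_derive_normal_pdf0 x => dp.
  apply: trigger_derive; rewrite /GRing.scale /= /dg; field.
  exact: s0.
have cp : continuous p by exact: continuous_normal_pdf.
have caff (h : R -> R) : continuous h -> continuous (fun x => h (t * x + b)).
  move=> ch x; apply: (@continuous_comp _ _ _ (fun x => t * x + b) h); last exact: ch.
  apply: continuousD; last exact: cst_continuous.
  by apply: continuousM => //; exact: cst_continuous.
have cdg : continuous dg.
  move=> x; apply: cvgB; apply: cvgM; try exact: cvg_cst.
    by apply: cvgM; [exact: cp|exact: (caff _ (@continuous_cos R))].
  apply: cvgM; last exact: (caff _ (@continuous_sin R)).
  by apply: cvgM; [exact: cvg_id|exact: cp].
have gle (e : R) : `|e| = 1 -> g (e * n%:R) @[n --> \oo] --> 0.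
  move=> e1; apply: norm_cvg0.
  apply: (@squeeze_cvgr _ _ _ _ (cst 0) (fun n => p (e * n%:R))).
  - near=> n; rewrite normr_ge0/= /g normrM.
    by rewrite (ger0_norm (normal_pdf_ge0 _ _ _)) ler_piMr ?normal_pdf_ge0// sin_max.
  - exact: cvg_cst.
  - exact: cvg_normal_pdf0.
have := integral_derive_vanishing gdg cdg.
rewrite (_ : EFin \o dg = (fun x => (t * (p x * cos (t * x + b)))%:E -
  ((s ^+ 2)^-1 * (x * p x * sin (t * x + b)))%:E)%E); last first.
  by apply/funext => x /=; rewrite -EFinB.
have gy : g n%:R @[n --> \oo] --> 0.
  by have := gle 1 (normr1 _); under eq_fun do rewrite mul1r.
have gNy : g (- n%:R) @[n --> \oo] --> 0.
  by have := gle (-1) (normrN1 _); under eq_fun do rewrite mulN1r.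
move=> /(_ (integrableB measurableT i1' i2') gy gNy).
rewrite /dg RintegralB// RintegralZl// RintegralZl//.
move/eqP; rewrite subr_eq0 => /eqP.
by rewrite -mulrA => ->; rewrite mulrA divff ?mul1r// sqrf_eq0.
Unshelve. all: by end_near. Qed.

(** Differentiation under the integral, dominated by [p x + x^2 p x], produces
    [- x p x sin (t x + b)]; integration by parts turns it back into the transform itself. *)
Lemma is_derive_cos_transform (b t : R) :
  is_derive t (1 : R) (fun t => \int[leb]_x (p x * cos (t * x + b)))
    (- (s ^+ 2 * t * \int[leb]_x (p x * cos (t * x + b)))).
Proof.
pose f (t x : R) := p x * cos (t * x + b).
have df (u x : R) : is_derive u (1 : R) (f ^~ x) (- (x * p x * sin (u * x + b))).
  apply: trigger_derive; rewrite /GRing.scale /=; ring.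
have d1E u x : partial1of2 f u x = - (x * p x * sin (u * x + b)).
  by rewrite partial1of2E derive_val.
pose g x := p x + x ^+ 2 * p x.
have g0 x : 0 <= g x.
  by rewrite addr_ge0 ?normal_pdf_ge0// mulr_ge0 ?sqr_ge0 ?normal_pdf_ge0.
have ig : leb.-integrable setT (EFin \o g).
  exact: (integrableD measurableT (integrable_normal_pdf 0 s)
    integrable_sqr_normal_pdf0).
have tI : (`](t - 1), (t + 1)[%classic : set R) t.
  by rewrite /= in_itv /=; lra.
have if_ (x : R) : (`](t - 1), (t + 1)[%classic : set R) x ->
    leb.-integrable setT (EFin \o f x).
  by move=> _; exact: integrable_cos_normal_pdf0.
have der (x y : R) : (`](t - 1), (t + 1)[%classic : set R) x -> [set: R] y ->
    derivable (f ^~ y) x 1.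
  by move=> _ _.
have ub (x y : R) : (`](t - 1), (t + 1)[%classic : set R) x -> [set: R] y ->
    `|partial1of2 f x y| <= g y.
  move=> _ _; rewrite d1E normrN.
  apply: (le_trans _ (norm_mul_normal_pdf0_le y)).
  by rewrite normrM ler_piMr// sin_max.
apply: DeriveDef.
  exact: (derivable_under_integral measurableT tI if_ der g0 ig ub).
rewrite -derive1E.
rewrite (differentiation_under_integral measurableT tI if_ der g0 ig ub).
rewrite -mul_sin_normal_pdf0.
under eq_Rintegral do rewrite d1E.
have msin : measurable_fun [set: R] (fun x => sin (t * x + b)).
  apply: (measurableT_comp (continuous_measurable_fun (@continuous_sin R))).
  by apply: measurable_funD => //; exact: measurable_funM.
have i2 := integrable_mul_normal_pdf0 msin (fun x => sin_max _).
by rewrite -mulN1r -RintegralZl//; apply: eq_Rintegral => x _; rewrite mulN1r.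
Qed.

(* As a function of [t] the integral solves [F' = - s^2 t F]. *)
Lemma cos_transform_normal_pdf0 (t b : R) :
  \int[leb]_x (p x * cos (t * x + b)) = expR (- (s ^+ 2 * t ^+ 2 / 2)) * cos b.
Proof.
pose F t := \int[leb]_x (p x * cos (t * x + b)).
pose H t := F t * expR (s ^+ 2 * t ^+ 2 / 2).
have dH (u : R) : is_derive u (1 : R) H 0.
  have dF := is_derive_cos_transform b u.
  apply: trigger_derive; rewrite /GRing.scale /=.
  by rewrite -/(F u); field.
have := @is_derive_0_is_cst R H t 0 dH.
rewrite /H expr0n /= mulr0 mul0r expR0 mulr1 => Ft.
rewrite -/(F t); have -> : F t = F 0 * expR (- (s ^+ 2 * t ^+ 2 / 2)).
  by rewrite -Ft -mulrA -expRD subrr expR0 mulr1.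
rewrite mulrC; congr (_ * _); rewrite /F.
under eq_Rintegral do rewrite mul0r add0r.
rewrite RintegralZr//; last exact: integrable_normal_pdf.
by rewrite /Rintegral integral_normal_pdf mul1r.
Qed.

(** The Radon-Nikodym derivative of [normal_prob] is almost everywhere the density, because both
    have the same integral over every measurable set. *)
Lemma integral_normal_prob (f : R -> R) :
  (normal_prob 0 s).-integrable setT (EFin \o f) ->
  (\int[normal_prob 0 s]_x (f x)%:E = \int[leb]_x (p x * f x)%:E)%E.
Proof.
move=> intf.
have ac := @normal_prob_dominates R 0 s.
rewrite -(Radon_Nikodym_change_of_variables ac)//=.
have mf := measurable_int _ intf.
apply: ae_eq_integral => //.
- exact: emeasurable_funM.
- apply/measurable_EFinP; apply: measurable_funM.
    exact: measurable_normal_pdf.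
  exact/measurable_EFinP.
- under [X in ae_eq _ _ _ X]eq_fun do rewrite mulrC EFinM.
  apply: ae_eqe_mul2l => /=.
  rewrite Radon_NikodymE//=.
  case: cid => /= h [h1 h2 h3].
  apply: integral_ae_eq => //=.
  + by apply/measurable_EFinP; exact: measurable_normal_pdf.
  + by move=> E E01 mE; rewrite -h3.
Qed.

End gaussian.

(** * Approximation by trigonometric polynomials *)

Section bernstein.
Context (R : realType).
Implicit Types (phi psi : nat -> R) (x : R).

(* The expectation of [phi] under the binomial law of parameters [n] and [x]. *)
Fixpoint bernstein n phi x : R :=
  if n is m.+1 then
    x * bernstein m (fun k => phi k.+1) x + (1 - x) * bernstein m phi x
  else phi 0%N.

Lemma le_bernstein n phi psi x : 0 <= x <= 1 ->
  (forall k, phi k <= psi k) -> bernstein n phi x <= bernstein n psi x.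
Proof.
move=> /andP[x0 x1]; elim: n phi psi => //= n IH phi psi pp.
by rewrite lerD// ler_wpM2l ?subr_ge0// IH.
Qed.

Lemma bernsteinN n phi x : bernstein n (fun k => - phi k) x = - bernstein n phi x.
Proof. by elim: n phi => //= n IH phi; rewrite !IH; ring. Qed.

Lemma bernstein_affine n a c phi x :
  bernstein n (fun k => a + c * phi k) x = a + c * bernstein n phi x.
Proof.
by elim: n phi => //= n IH phi; rewrite (IH (fun k => phi k.+1)) IH; ring.
Qed.

(** Variance plus squared bias of the binomial law. The center [a] is arbitrary because a success in
    the first trial changes it to [a - 1]. *)
Lemma bernstein_sqr n a x : bernstein n (fun k => (k%:R - a) ^+ 2) x =
  n%:R * (x * (1 - x)) + (n%:R * x - a) ^+ 2.
Proof.
elim: n a => [a|n IH a] /=; first by ring.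
have -> : (fun k : nat => (k.+1%:R - a) ^+ 2) = (fun k => (k%:R - (a - 1)) ^+ 2).
  by apply/funext => k; rewrite -natr1; ring.
by rewrite !IH -natr1; ring.
Qed.

(** Chebyshev's inequality in Bernstein's proof of the Weierstrass theorem: the square stands for
    the indicator of a deviation beyond [delta] and averages to [x (1 - x) / (n delta^2)]. *)
Lemma bernstein_dist n phi x c (e C delta : R) : (0 < n)%N -> 0 <= x <= 1 ->
  0 <= C -> 0 < delta ->
  (forall k, `|phi k - c| <= e + C * ((k%:R / n%:R - x) / delta) ^+ 2) ->
  `|bernstein n phi x - c| <= e + C / delta ^+ 2 * n%:R^-1.
Proof.
move=> n0 x01 C0 d0 phic.
have n0' : n%:R != 0 :> R by rewrite pnatr_eq0 -lt0n.
pose psi (k : nat) := e + C / (n%:R * delta) ^+ 2 * (k%:R - n%:R * x) ^+ 2.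
have psiE k : psi k = e + C * ((k%:R / n%:R - x) / delta) ^+ 2.
  by rewrite /psi; field; rewrite n0' gt_eqF.
have Bpsi : bernstein n psi x <= e + C / delta ^+ 2 * n%:R^-1.
  rewrite bernstein_affine bernstein_sqr subrr expr0n addr0 lerD2l.
  rewrite (_ : _ * _ = C / delta ^+ 2 * n%:R^-1 * (x * (1 - x))); last first.
    by field; rewrite n0' gt_eqF.
  case/andP: x01 => x0 x1; rewrite ler_piMr//.
    by rewrite mulr_ge0 ?invr_ge0 ?divr_ge0 ?sqr_ge0// ler0n.
  by nra.
have Bc phi' : bernstein n (fun k => phi' k - c) x = bernstein n phi' x - c.
  have := bernstein_affine n (- c) 1 phi' x; rewrite mul1r addrC => <-.
  by congr bernstein; apply/funext => k; ring.
rewrite -Bc ler_norml; apply/andP; split; last first.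
  apply: le_trans Bpsi; apply: le_bernstein => // k.
  by rewrite psiE (le_trans (ler_norm _)).
rewrite lerNl -bernsteinN; apply: le_trans Bpsi; apply: le_bernstein => // k.
by rewrite psiE (le_trans (ler_norm _))// normrN.
Qed.

Lemma bernstein_norm_le n phi x K : 0 <= x <= 1 ->
  (forall k, `|phi k| <= K) -> `|bernstein n phi x| <= K.
Proof.
move=> x01 phiK.
have BK : bernstein n (fun=> K) x = K.
  by elim: (n) => //= m ->; ring.
rewrite ler_norml -{1 2}BK -bernsteinN; apply/andP; split;
  by apply: le_bernstein => // k; have := phiK k; rewrite ler_norml => /andP[].
Qed.

End bernstein.

Section trigonometric.
Context (R : realType).
Implicit Types f g : R -> R.

(** The phase brings in the sines, and [t = 0] the constants. Having only linear constructors makes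
    the passage from cosines to [trig_poly] a linear induction; products come from
    [trig_poly_mul_cos]. *)
Inductive trig_poly : (R -> R) -> Prop :=
| trig_poly_cos t b : trig_poly (fun x => cos (t * x + b))
| trig_polyD f g : trig_poly f -> trig_poly g -> trig_poly (fun x => f x + g x)
| trig_polyZ c f : trig_poly f -> trig_poly (fun x => c * f x).

Lemma trig_poly_cst c : trig_poly (fun=> c).
Proof.
have := trig_polyZ c (trig_poly_cos 0 0); congr trig_poly.
by apply/funext => x; rewrite mul0r addr0 cos0 mulr1.
Qed.

Lemma trig_poly_mul_cos s c f : trig_poly f ->
  trig_poly (fun x => cos (s * x + c) * f x).
Proof.
elim=> [t b|g h _ IHg _ IHh|a g _ IHg].
- have -> : (fun x => cos (s * x + c) * cos (t * x + b)) = (fun x =>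
      2^-1 * (cos ((s + t) * x + (c + b)) + cos ((s - t) * x + (c - b)))).
    apply/funext => x.
    have -> : (s + t) * x + (c + b) = (s * x + c) + (t * x + b) by ring.
    have -> : (s - t) * x + (c - b) = (s * x + c) - (t * x + b) by ring.
    by move: (s * x + c) (t * x + b) => y z; rewrite cosD cosB; field.
  by apply: trig_polyZ; apply: trig_polyD; exact: trig_poly_cos.
- by have := trig_polyD IHg IHh; congr trig_poly; apply/funext => x; ring.
- by have := trig_polyZ a IHg; congr trig_poly; apply/funext => x; ring.
Qed.

Lemma trig_poly_bernstein n phi (s b : R) :
  trig_poly (fun y => bernstein n phi ((1 + cos (s * y + b)) / 2)).
Proof.
elim: n phi => [phi|n IH phi] /=; first exact: trig_poly_cst.
have h1 := IH (fun k => phi k.+1); have h0 := IH phi.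
have := trig_polyZ 2^-1 (trig_polyD (trig_polyD h1 (trig_poly_mul_cos s b h1))
  (trig_polyD h0 (trig_polyZ (-1) (trig_poly_mul_cos s b h0)))).
by congr trig_poly; apply/funext => y; field.
Qed.

(* On [|y| <= M] the change of variable [u y = (1 + sin (y / (2 M))) / 2] is
   injective with values in a compact subset of ]0, 1[, where [f] becomes the
   function [g] below; the Bernstein polynomials of [g] are trigonometric in [y]
   and hence bounded on the whole line. *)
Lemma trig_poly_approx (f : R -> R) (K M e : R) : continuous f ->
  (forall x, `|f x| <= K) -> 0 < M -> 0 < e ->
  exists T, [/\ trig_poly T, forall y, `|T y| <= K &
    forall y, `|y| <= M -> `|f y - T y| <= e].
Proof.
move=> cf fK M0 e0.
pose u (y : R) : R := (1 + sin (y / (2 * M))) / 2.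
pose g (z : R) : R := f (2 * M * asin (2 * z - 1)).
have u01 y : 0 <= u y <= 1.
  have := sin_max (y / (2 * M)); rewrite ler_norml /u => /andP[? ?].
  by apply/andP; split; lra.
have cu : continuous u.
  move=> y; apply: cvgM; last exact: cvg_cst.
  apply: cvgD; first exact: cvg_cst.
  apply: (cvg_comp (fun y => y / (2 * M)) (@sin R)).
    by apply: cvgM; [exact: cvg_id|exact: cvg_cst].
  exact: continuous_sin.
(* The factor [2] leaves room: [|y / (2 M)| <= 1/2], while [pi / 2 >= 1]. There [asin] inverts the
   sine, and the sine stays strictly inside []-1, 1[]. *)
have yM y : `|y| <= M -> - (pi / 2) < y / (2 * M) < pi / 2.
  have pi2 := pihalf_ge1 R.
  have M2 : 0 < 2 * M by rewrite mulr_gt0.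
  rewrite ler_norml => /andP[y1 y2].
  by rewrite ltr_pdivlMr// ltr_pdivrMr//; apply/andP; split; nra.
have gu y : `|y| <= M -> g (u y) = f y.
  move=> /yM /andP[h1 h2]; rewrite /g /u.
  have -> : 2 * ((1 + sin (y / (2 * M))) / 2) - 1 = sin (y / (2 * M)) by field.
  by rewrite sinK ?in_itv /= ?ltW// mulrC divfK ?gt_eqF ?mulr_gt0.
have cg y : `|y| <= M -> {for u y, continuous g}.
  move=> yM'.
  have h : -1 < 2 * u y - 1 < 1.
    have -> : 2 * u y - 1 = sin (y / (2 * M)) by rewrite /u; field.
    have := cos_gt0_pihalf (yM _ yM') => c0.
    have := cos2Dsin2 (y / (2 * M)) => cs.
    by rewrite -ltr_norml -(expr_lt1 (n := 2))// -normrX ger0_norm ?sqr_ge0//; nra.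
  apply: (cvg_comp (fun z => 2 * M * asin (2 * z - 1)) f); last exact: cf.
  apply: cvgM; first exact: cvg_cst.
  apply: (cvg_comp (fun z => 2 * z - 1) (@asin R)); last exact: continuous_asin.
  apply: cvgB; last exact: cvg_cst.
  by apply: cvgM; [exact: cvg_cst|exact: cvg_id].
(* Compactness of [[-M, M]] makes [delta] independent of [y]. The point [z] is any real, since the
   nodes [k / n] need not be values of [u] on [[-M, M]]. *)
have [delta d0 dP] : exists2 delta, 0 < delta & forall y z, `|y| <= M ->
    `|z - u y| < delta -> `|g z - f y| <= e / 2.
  have cM : compact (`[(- M), M]%classic : set R) by exact: segment_compact.
  move/compact_near_coveringP : cM.
  move=> /(_ R (0^'+)%R (fun d y => forall z, `|z - u y| < d -> `|g z - f y| <= e / 2) _).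
  move=> cov; have nd : \forall d \near (0 : R)^'+, `[(- M), M]%classic `<=`
      (fun y : R => forall z : R, `|z - u y| < d -> `|g z - f y| <= e / 2).
    apply: cov => y yI.
    have yM' : `|y| <= M by move: yI; rewrite /= in_itv /= -ler_norml.
    have e4 : 0 < e / 4 by rewrite divr_gt0.
    have /cvgrPdist_lt/(_ _ e4)/nbhs_ballP[eta /= eta0 etaP] := cg y yM'.
    have eta2 : 0 < eta / 2 by rewrite divr_gt0.
    near=> y' d => z /= zu.
    have dd : d < eta / 2 by near: d; exact: nbhs_right_lt.
    have uu : `|u y - u y'| < eta / 2.
      by near: y'; have /cvgrPdist_lt := cu y; apply.
    have ff : `|f y - f y'| < e / 4.
      by near: y'; have /cvgrPdist_lt := cf y; apply.
    have := etaP z; rewrite /ball /= gu// => gz.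
    have {}gz : `|f y - g z| < e / 4.
      apply: gz; rewrite (_ : u y - z = (u y - u y') - (z - u y')); last by ring.
      by rewrite (le_lt_trans (ler_normB _ _))//; lra.
    rewrite (_ : g z - f y' = (f y - f y') - (f y - g z)); last by ring.
    by rewrite (le_trans (ler_normB _ _))//; lra.
  have [d [d0 dP]] : exists d : R, 0 < d /\ `[(- M), M]%classic `<=`
      (fun y : R => forall z : R, `|z - u y| < d -> `|g z - f y| <= e / 2).
    near ((0 : R)^'+) => d; exists d; split; last by near: d.
    by near: d; exact: nbhs_right_gt.
  by exists d => // y z yM'; apply: dP; rewrite /= in_itv /= -ler_norml.
have K0 : 0 <= K by rewrite (le_trans _ (fK 0)).
near \oo => n.
have n0 : (0 < n)%N by near: n; exact: nbhs_infty_gt.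
exists (fun y => bernstein n (fun k => g (k%:R / n%:R)) (u y)); split.
- have -> : u = fun y => (1 + cos ((2 * M)^-1 * y + - (pi / 2))) / 2.
    apply/funext => y; rewrite /u cosB cos_pihalf sin_pihalf mulr0 add0r mulr1.
    by rewrite (mulrC _ y).
  exact: trig_poly_bernstein.
- by move=> y; apply: bernstein_norm_le => // k; exact: fK.
- move=> y yM'; rewrite distrC.
  have bd : forall k, `|g (k%:R / n%:R) - f y| <=
      e / 2 + 2 * K * ((k%:R / n%:R - u y) / delta) ^+ 2.
    move=> k; have [lt|ge] := ltP `|k%:R / n%:R - u y| delta.
      by rewrite (le_trans (dP _ _ yM' lt))// lerDl mulr_ge0 ?sqr_ge0// mulr_ge0.
    have : 1 <= ((k%:R / n%:R - u y) / delta) ^+ 2.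
      rewrite -(real_normK (num_real _)) expr_ge1// normf_div (gtr0_norm d0).
      by rewrite ler_pdivlMr// mul1r.
    have gK : `|g (k%:R / n%:R)| <= K by exact: fK.
    move: (_ ^+ 2) => q q1.
    have Kq : 2 * K <= 2 * K * q by rewrite ler_peMr// mulr_ge0.
    by have fy := fK y; rewrite (le_trans (ler_normB _ _))//; lra.
  apply: (le_trans (bernstein_dist n0 (u01 y) _ d0 bd)); first by rewrite mulr_ge0.
  rewrite [leRHS](splitr e) lerD2l.
  near: n.
  have : (2 * K / delta ^+ 2 * n%:R^-1 : R) @[n --> \oo] --> 2 * K / delta ^+ 2 * 0.
    by apply: cvgM; [exact: cvg_cst|exact: cvg_natV].
  rewrite mulr0 => /cvgrPdist_le/(_ (e / 2)); rewrite divr_gt0// => /(_ isT).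
  apply: filterS => n; rewrite sub0r normrN; exact: le_trans (ler_norm _).
Unshelve. all: by end_near. Qed.

End trigonometric.

(** * Weak convergence *)

Section weak_convergence.
Context (R : realType).
Local Notation measR := (measurableTypeR R).
Implicit Types (P : probability (measurableTypeR R) R).

Lemma continuous_integrableR P (f : R -> R) K : continuous f ->
  (forall x, `|f x| <= K) -> integrableR P f.
Proof.
move=> cf fK; apply: (@integrableR_bounded _ _ _ _ _ K) => //.
exact: continuous_measurable_fun.
Qed.

Lemma trig_poly_continuous (T : R -> R) : trig_poly T -> continuous T.
Proof.
elim=> [t b|g h _ IHg _ IHh|a g _ IHg] x.
- apply: (cvg_comp (fun x => t * x + b) (@cos R)); last exact: continuous_cos.
  apply: cvgD; last exact: cvg_cst.
  by apply: cvgM; [exact: cvg_cst|exact: cvg_id].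
- by apply: cvgD; [exact: IHg|exact: IHh].
- by apply: cvgM; [exact: cvg_cst|exact: IHg].
Qed.

Lemma trig_poly_bounded (T : R -> R) : trig_poly T ->
  exists K, forall x, `|T x| <= K.
Proof.
elim=> [t b|g h _ [K gK] _ [L hL]|a g _ [K gK]].
- by exists 1 => x; exact: cos_max.
- by exists (K + L) => x; rewrite (le_trans (ler_normD _ _))// lerD.
- by exists (`|a| * K) => x; rewrite normrM ler_wpM2l.
Qed.

Lemma trig_poly_integrableR P (T : R -> R) : trig_poly T -> integrableR P T.
Proof.
move=> tT; have [K TK] := trig_poly_bounded tT.
exact: (continuous_integrableR _ (trig_poly_continuous tT) TK).
Qed.

Lemma cvg_mean_trig_poly (P_ : nat -> probability measR R)
    (P : probability measR R) :
  (forall t b, mean (P_ n) (fun x => cos (t * x + b)) @[n --> \oo] -->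
    mean P (fun x => cos (t * x + b))) ->
  forall T, trig_poly T -> mean (P_ n) T @[n --> \oo] --> mean P T.
Proof.
move=> cc T; elim=> [//|g h tg IHg th IHh|a g tg IHg].
- rewrite meanD; [|exact: trig_poly_integrableR..].
  rewrite (_ : (fun n => mean (P_ n) _) =
      (fun n => mean (P_ n) g + mean (P_ n) h)); first exact: cvgD.
  by apply/funext => n; rewrite meanD//; exact: trig_poly_integrableR.
- rewrite meanZ; last exact: trig_poly_integrableR.
  rewrite (_ : (fun n => mean (P_ n) _) = (fun n => a * mean (P_ n) g)).
    by apply: cvgM; first exact: cvg_cst.
  by apply/funext => n; rewrite meanZ//; exact: trig_poly_integrableR.
Qed.

(** A majorant of the indicator of [|x| > M]. Being bounded, it is integrable under the limit law
    and its mean tends to [0] there; under [P_ n] it is controlled by the second moment over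
    [M^2]. *)
Definition truncated_sqr (M x : R) := Num.min 1 ((x / M) ^+ 2).

Lemma measurable_truncated_sqr M :
  measurable_fun [set: measR] (truncated_sqr M : measR -> R).
Proof.
apply: measurable_minr => //; apply: measurable_funX.
exact: measurable_funM.
Qed.

Lemma truncated_sqr_itv M x : 0 <= truncated_sqr M x <= 1.
Proof. by rewrite /truncated_sqr le_min ler01 sqr_ge0 ge_min lexx. Qed.

Lemma truncated_sqr_integrableR P M : integrableR P (truncated_sqr M).
Proof.
apply: (@integrableR_bounded _ _ _ _ _ 1); first exact: measurable_truncated_sqr.
by move=> x; have /andP[? ?] := truncated_sqr_itv M x; rewrite ger0_norm.
Qed.

Lemma cvg_mean_truncated_sqr P :
  mean P (truncated_sqr n%:R) @[n --> \oo] --> 0.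
Proof.
suff : (\int[P]_x (truncated_sqr n%:R x)%:E)%E @[n --> \oo] -->
    (\int[P]_x (cst 0 x))%E.
  rewrite integral0; under eq_fun do rewrite (meanE (truncated_sqr_integrableR _ _)).
  by move/fine_cvg.
apply: (@dominated_cvg _ _ _ P _ measurableT _ _ (cst 1%E)) => //.
- move=> n; apply/measurable_EFinP.
  exact: measurable_truncated_sqr.
- move=> x _; apply: cvg_EFin; first exact: nearW.
  apply: (@squeeze_cvgr _ _ _ _ (cst 0) (fun n => `|x| ^+ 2 * n%:R^-1)).
  + near=> n; have /andP[-> _] /= := truncated_sqr_itv n%:R x.
    rewrite /truncated_sqr ge_min; apply/orP; right.
    have n0 : (0 < n)%N by near: n; exact: nbhs_infty_gt.
    rewrite expr_div_n real_normK ?num_real// ler_wpM2l ?sqr_ge0//.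
    by rewrite lef_pV2 ?posrE ?exprn_gt0 ?ltr0n// ler_eXnr ?ler1n.
  + exact: cvg_cst.
  + rewrite -(mulr0 (`|x| ^+ 2)); apply: cvgM; first exact: cvg_cst.
    exact: cvg_natV.
- exact: integrableR_cst.
- move=> n x _; have /andP[? ?] := truncated_sqr_itv n%:R x.
  by rewrite lee_fin ger0_norm.
Unshelve. all: by end_near. Qed.

Lemma mean_truncated_sqr_le P M : 0 < M ->
  integrableR P (fun x => x ^+ 2) ->
  mean P (truncated_sqr M) <= M^-1 ^+ 2 * mean P (fun x => x ^+ 2).
Proof.
move=> M0 i2; rewrite -meanZ//; apply: le_mean.
- exact: truncated_sqr_integrableR.
- exact: integrableRZ.
- by move=> x; rewrite /truncated_sqr ge_min exprMn mulrC lexx orbT.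
Qed.

(** Outside [[-M, M]] the difference is at most [2 K], as [T] obeys the same bound as [f] on the
    whole line. *)
Lemma mean_trig_poly_approx P (f T : R -> R) (K M e : R) :
  continuous f -> trig_poly T -> 0 < M ->
  (forall x, `|f x| <= K) -> (forall x, `|T x| <= K) ->
  (forall y, `|y| <= M -> `|f y - T y| <= e) ->
  `|mean P f - mean P T| <= e + 2 * K * mean P (truncated_sqr M).
Proof.
move=> cf tT M0 fK TK fT.
have K0 : 0 <= K by rewrite (le_trans _ (fK 0)).
have e0 : 0 <= e.
  by have := fT 0; rewrite normr0 => /(_ (ltW M0)); exact: le_trans.
have sf := continuous_integrableR P cf fK.
have sT := trig_poly_integrableR P tT.
have st := truncated_sqr_integrableR P M.
rewrite -meanB//; apply: (le_trans (le_norm_mean (integrableRB sf sT))).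
have sKt := integrableRZ (2 * K) st; have se := integrableR_cst P e.
rewrite -meanZ// -[X in X + _](mean_cst P e) -meanD//.
apply: le_mean.
- by apply: integrableR_norm; exact: integrableRB.
- exact: integrableRD.
move=> x; have /andP[t0 t1] := truncated_sqr_itv M x.
have [xM|Mx] := leP `|x| M.
  by rewrite (le_trans (fT x xM))// lerDl mulr_ge0// mulr_ge0.
have -> : truncated_sqr M x = 1.
  apply/min_idPl; rewrite -(real_normK (num_real _)) expr_ge1// normf_div.
  by rewrite (gtr0_norm M0) ler_pdivlMr// mul1r ltW.
have fx := fK x; have Tx := TK x.
by rewrite (le_trans (ler_normB _ _))//; lra.
Qed.

(** [M] is chosen from the tails, uniformly in [n]; then [T] is chosen for [f] on [[-M, M]]; only
    then is [n] taken large for this [T]. *)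
Lemma weak_cvg_trig (P_ : nat -> probability measR R)
    (P : probability measR R) (C : R) :
  (forall n, integrableR (P_ n) (fun x => x ^+ 2)) ->
  (forall n, mean (P_ n) (fun x => x ^+ 2) <= C) ->
  (forall t b, mean (P_ n) (fun x => cos (t * x + b)) @[n --> \oo] -->
    mean P (fun x => cos (t * x + b))) ->
  weak_cvg P_ P.
Proof.
(* Boundedness gives a bound for every number strictly above [K0]; [|K0| + 1] is such a number and
   is positive. *)
move=> i2 m2 cc f cf [K0 [_ /(_ (`|K0| + 1))]].
rewrite (le_lt_trans (ler_norm _)) ?ltrDl// => /(_ isT) bf.
pose K := `|K0| + 1; have K_gt0 : 0 < K by rewrite /K ltr_wpDl.
have fK x : `|f x| <= K by exact: bf.
have sf P' : integrableR P' f by exact: (continuous_integrableR _ cf fK).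
rewrite meanE//; under eq_fun do rewrite meanE//.
apply: cvg_EFin; first exact: nearW.
apply/cvgrPdist_le => /= e e0.
have C0 : 0 <= C by rewrite (le_trans _ (m2 0%N))// mean_ge0// => x; exact: sqr_ge0.
(* Three errors [e'] (two approximations and the convergence for [T]) and two tails [2 K e']. *)
pose e' := e / (3 + 4 * K).
have K3 : 0 < 3 + 4 * K by rewrite addr_gt0// mulr_gt0.
have e'0 : 0 < e' by rewrite divr_gt0.
have [M [M0 MP MC]] : exists M, [/\ 0 < M, mean P (truncated_sqr M) <= e' &
    M^-1 ^+ 2 * C <= e'].
  near \oo => n; exists n%:R; split.
  - by rewrite ltr0n; near: n; exact: nbhs_infty_gt.
  - near: n; have /cvgrPdist_le/(_ _ e'0) := cvg_mean_truncated_sqr P.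
    apply: filterS => n; rewrite sub0r normrN; exact: le_trans (ler_norm _).
  - near: n.
    have : (n%:R^-1 ^+ 2 * C : R) @[n --> \oo] --> 0 ^+ 2 * C.
      apply: cvgM; last exact: cvg_cst.
      by apply: cvgM; exact: cvg_natV.
    rewrite expr0n mul0r => /cvgrPdist_le/(_ _ e'0).
    apply: filterS => n; rewrite sub0r normrN; exact: le_trans (ler_norm _).
have [T [tT TK fT]] := trig_poly_approx cf fK M0 e'0.
have /cvgrPdist_le/(_ _ e'0) := cvg_mean_trig_poly cc tT.
apply: filterS => n TPn.
have h1 := mean_trig_poly_approx P cf tT M0 fK TK fT.
have h2 := mean_trig_poly_approx (P_ n) cf tT M0 fK TK fT.
have hn : mean (P_ n) (truncated_sqr M) <= e'.
  apply: (le_trans (mean_truncated_sqr_le M0 (i2 n))).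
  by apply: le_trans MC; rewrite ler_wpM2l ?sqr_ge0.
have k1 : 2 * K * mean P (truncated_sqr M) <= 2 * K * e'.
  by rewrite ler_wpM2l// mulr_ge0 ?ltW.
have k2 : 2 * K * mean (P_ n) (truncated_sqr M) <= 2 * K * e'.
  by rewrite ler_wpM2l// mulr_ge0 ?ltW.
have -> : e = e' + 2 * (e' + 2 * K * e').
  by rewrite /e'; field; rewrite gt_eqF.
rewrite (_ : _ - _ = (mean P f - mean P T) + (mean P T - mean (P_ n) T) -
  (mean (P_ n) f - mean (P_ n) T)); last by ring.
rewrite (le_trans (ler_normB _ _))// (le_trans (lerD (ler_normD _ _) (lexx _)))//.
by lra.
Unshelve. all: by end_near. Qed.

End weak_convergence.

(** * Application to the cocycle *)

Section gaussian_law.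
Context (R : realType).
Local Notation measR := (measurableTypeR R).

(** One formula for the Dirac mass and the normal laws, so that the degenerate variance needs no
    separate treatment afterwards. *)
Lemma mean_cos_gaussian_law (v t b : R) : 0 <= v ->
  mean (gaussian_law v) (fun x => cos (t * x + b)) =
  expR (- (v * t ^+ 2 / 2)) * cos b.
Proof.
move=> v0; rewrite /gaussian_law; case: eqVneq => [->|vn0].
  rewrite /mean /Rintegral integral_dirac//.
    by rewrite diracT mul1e /= mulr0 add0r !mul0r oppr0 expR0 mul1r.
  by apply/measurable_EFinP; exact: measurable_cos_affine.
have s0 : Num.sqrt v != 0 by rewrite gt_eqF// sqrtr_gt0 lt0r vn0.
have := cos_transform_normal_pdf0 s0 t b; rewrite (sqr_sqrtr v0) => <-.
congr fine.
have ic : (normal_prob 0 (Num.sqrt v)).-integrable setT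
    (EFin \o (fun x => cos (t * x + b))).
  apply: (@integrableR_bounded _ _ _ (normal_prob 0 (Num.sqrt v)) _ 1).
    exact: measurable_cos_affine.
  by move=> x; exact: cos_max.
exact: integral_normal_prob ic.
Qed.

End gaussian_law.

(** * Laws, expectations and variances in terms of [mean] and [norm2] *)

Section distribution.
Context d (T : measurableType d) (R : realType) (P : probability T R).
Local Notation measR := (measurableTypeR R).

Lemma mean_distribution (X : {RV P >-> measR}) (h : measR -> R) :
  measurable_fun setT h -> integrableR P (h \o X) ->
  integrableR (distribution P X) h /\
  mean (distribution P X) h = mean P (h \o X).
Proof.
move=> mh ih; have mh' : measurable_fun setT (EFin \o h) by exact/measurable_EFinP.
split.
  exact: (integrable_pushforward (measurable_funPT X) mh' ih measurableT).
rewrite /mean /Rintegral; congr fine.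
exact: (integral_pushforward (measurable_funPT X) mh' ih measurableT).
Qed.

Lemma expectation_sqr_lty (f : T -> R) : measurable_fun setT f ->
  ('E_P[(fun w => `|f w| ^+ 2)%R] < +oo)%E -> square_integrable P f.
Proof.
move=> mf; rewrite unlock => fy; split => //; apply/integrableP; split.
  by apply/measurable_EFinP; exact: measurable_funX.
by under eq_integral do rewrite /= normrX.
Qed.

Lemma expectation_sqr_le (f : T -> R) (tau : R) : measurable_fun setT f ->
  ('E_P[(fun w => `|f w| ^+ 2)%R] <= tau%:E)%E ->
  square_integrable P f /\ norm2 P f <= Num.sqrt tau.
Proof.
move=> mf ftau; have sf : square_integrable P f.
  by apply: expectation_sqr_lty => //; apply: le_lt_trans ftau _; exact: ltry.
split => //; apply: ler_wsqrtr; rewrite -lee_fin -meanE; last by case: sf.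
move: ftau; rewrite unlock.
by under eq_integral do rewrite real_normK ?num_real//.
Qed.

Lemma expectation_mean (f : T -> R) : integrableR P f ->
  ('E_P[f] = (mean P f)%:E)%E.
Proof. by move=> sf; rewrite unlock meanE. Qed.

Lemma variance_norm2 (f : T -> R) : square_integrable P f ->
  'V_P[f]%E = (norm2 P (fun w => f w - mean P f) ^+ 2)%:E.
Proof.
move=> sf; have := square_integrableB sf (square_integrable_cst P (mean P f)).
move=> -[mc sc]; rewrite /variance unlock.
rewrite (expectation_mean (square_integrable_integrableR sf)) /=.
by rewrite unlock norm2_sqr -meanE.
Qed.

End distribution.

Section cocycle.
Context (R : realType) (d : measure_display) (G : measurableType d).
Variables (mu : probability G R) (Q : adapted_cocycle G R).
Hypothesis moment2 : finite_second_moment mu Q.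
Hypothesis deviation2 : second_moment_deviation mu Q.
Local Notation Om := (seqspace G).
Local Notation P := (product_measure mu).

Lemma measurable_defect n m : measurable_fun [set: Om] (defect Q n m : Om -> R).
Proof.
apply: measurable_funB; last first.
  exact: (measurableT_comp (measurable_cocycle Q m) (@measurable_shift _ G n)).
by apply: measurable_funB; exact: measurable_cocycle.
Qed.

Lemma defect_norm2 : exists2 c, 0 <= c & forall n m,
  square_integrable P (defect Q n m : Om -> R) /\
  norm2 P (defect Q n m : Om -> R) <= c.
Proof.
have [tau H] := deviation2; exists (Num.sqrt tau); first exact: sqrtr_ge0.
by move=> n m; apply: expectation_sqr_le (H n m); exact: measurable_defect.
Qed.

(** The cocycle grows by a shifted copy of [Q 1] and one defect, both square-integrable. *)
Lemma cocycle_square_integrable n : square_integrable P (Q n).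
Proof.
have [c c0 dc] := defect_norm2.
have s1 : square_integrable P (Q 1%N).
  by apply: expectation_sqr_lty moment2; exact: measurable_cocycle.
elim: n => [|n IH].
  have -> : (Q 0%N : Om -> R) = fun=> 0 by apply/funext => w; exact: cocycle0.
  exact: square_integrable_cst.
have -> : (Q n.+1 : Om -> R) = (fun w => Q n w + Q 1%N (shift n w) + defect Q n 1 w).
  by apply/funext => w; rewrite /defect addn1; ring.
apply: square_integrableD; last by case: (dc n 1%N).
by apply: square_integrableD => //; exact: square_integrable_shift.
Qed.

Let a n : R := mean P (Q n).

Let integrable_cocycle n : integrableR P (Q n).
Proof. exact/square_integrable_integrableR/cocycle_square_integrable. Qed.

Let mean_defect n m : mean P (defect Q n m) = a (n + m)%N - a n - a m.
Proof.
have iQ := integrable_cocycle.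
rewrite /defect meanB ?meanB ?mean_shift//.
- exact: integrableRB.
- exact: integrableR_shift.
Qed.

Lemma mean_cocycle_dist : exists2 c, 0 <= c & forall n m,
  `|a (n + m)%N - a n - a m| <= c.
Proof.
have [c c0 dc] := defect_norm2; exists c => // n m; have [sd dn] := dc n m.
by apply: le_trans dn; rewrite -mean_defect; exact: norm_mean_le_norm2.
Qed.

(** An almost additive sequence stays within a constant of a linear one. Linear accumulation of
    errors is affordable here because the division is by [n m] and not by its square root: [a m / m]
    is within [c / m] of [a (n m) / (n m)]. *)
Lemma mean_cocycle_limit : exists l c : R, [/\ 0 <= c,
  (a n / n%:R) @[n --> \oo] --> l & forall n, `|a n - l * n%:R| <= c].
Proof.
have [c c0 ac] := mean_cocycle_dist.
have aM m n : `|a (n.+1 * m)%N - n.+1%:R * a m| <= n.+1%:R * c.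
  elim: n => [|n IH]; first by rewrite mul1n mul1r subrr normr0 mulr_ge0.
  have h := ac (n.+1 * m)%N m.
  have -> : (n.+2 * m = n.+1 * m + m)%N by rewrite [in LHS]mulSn addnC.
  rewrite -[n.+2%:R]natr1.
  rewrite (_ : _ - _ = (a (n.+1 * m + m)%N - a (n.+1 * m)%N - a m) +
    (a (n.+1 * m)%N - n.+1%:R * a m)); last by ring.
  by rewrite (le_trans (ler_normD _ _))// mulrDl mul1r addrC lerD.
have H n m : (0 < n)%N -> (0 < m)%N ->
    `|a (n * m)%N / (n * m)%:R - a m / m%:R| <= c * m%:R^-1.
  move=> n0 m0; have n0' : 0 < n%:R :> R by rewrite ltr0n.
  have m0' : 0 < m%:R :> R by rewrite ltr0n.
  rewrite (_ : _ - _ = (n%:R * m%:R)^-1 * (a (n * m)%N - n%:R * a m)).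
    rewrite normrM ger0_norm ?invr_ge0 ?mulr_ge0 ?ler0n//.
    rewrite ler_pdivrMl ?mulr_gt0//.
    have := aM m n.-1; rewrite prednK// => /le_trans; apply.
    by rewrite le_eqVlt; apply/orP; left; apply/eqP; field; rewrite gt_eqF.
  by rewrite natrM; field; rewrite !gt_eqF.
have [l [al dl]] := @cvg_of_dist_le _ (fun n => a n / n%:R)
  (fun n => c * n%:R^-1) ltac:(by rewrite -(mulr0 c); apply: cvgM;
    [exact: cvg_cst|exact: cvg_natV]) ltac:(
  move=> n m n0 m0; have h1 := H m n m0 n0; have h2 := H n m n0 m0;
  rewrite (_ : _ - _ = (a (n * m)%N / (n * m)%:R - a m / m%:R) -
    (a (m * n)%N / (m * n)%:R - a n / n%:R));
  [by rewrite (le_trans (ler_normB _ _))// addrC lerD|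
   by rewrite (mulnC m n); ring]).
exists l, c; split=> // -[|n].
  have -> : a 0%N = 0.
    rewrite /a (eq_mean _ (g := fun=> 0)) ?mean_cst// => w; exact: cocycle0.
  by rewrite mulr0 subrr normr0.
have := dl n.+1 (ltn0Sn n).
have n0 : 0 < n.+1%:R :> R by rewrite ltr0n.
rewrite (_ : a n.+1 / _ - l = (a n.+1 - l * n.+1%:R) / n.+1%:R); last first.
  by field; rewrite gt_eqF.
by rewrite normrM normfV (gtr0_norm n0) ler_pdivrMr// divfK// gt_eqF.
Qed.

Lemma rate_of_escapeP (l : R) : (a n / n%:R) @[n --> \oo] --> l ->
  rate_of_escape mu Q = l.
Proof.
move=> al; rewrite /rate_of_escape.
rewrite (_ : (fun n => _) = (fun n => (a n / n%:R)%:E)); last first.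
  apply/funext => n; rewrite expectation_mean ?EFinM 1?muleC//.
suff -> : limn (fun n => (a n / n%:R)%:E) = l%:E by [].
by apply/cvg_lim => //; apply: cvg_EFin => //; exact: nearW.
Qed.

Let q n (w : Om) : R := Q n w - a n.

Let q0 w : q 0%N w = 0.
Proof.
rewrite /q /a (eq_mean _ (g := fun=> 0)) ?mean_cst ?cocycle0 ?subr0// => w'.
exact: cocycle0.
Qed.

Let q_prefix n : prefix_determined n (q n).
Proof. by move=> w w' ag; rewrite /q (cocycle_prefix_determined Q ag). Qed.

Let q2 n : square_integrable P (q n).
Proof.
apply: square_integrableB; first exact: cocycle_square_integrable.
exact: square_integrable_cst.
Qed.

Let q_mean n : mean P (q n) = 0.
Proof.
by rewrite meanB ?mean_cst ?subrr//; exact: integrableR_cst.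
Qed.

(** The defect of the centered cocycle is the centered defect, whose norm is no larger. *)
Let q_defect : exists2 c, 0 <= c & forall n m,
  norm2 P (fun w => q (n + m)%N w - q n w - q m (shift n w)) <= c.
Proof.
have [c c0 dc] := defect_norm2; exists c => // n m; have [sd dn] := dc n m.
apply: le_trans dn; apply: le_trans (norm2_center sd).
rewrite (_ : (fun w => _) = fun w => defect Q n m w - mean P (defect Q n m))//.
apply/funext => w.
by rewrite mean_defect /q /defect; ring.
Qed.

Lemma asymptotic_varianceP (sigma : R) :
  norm2 P (q n) / Num.sqrt n%:R @[n --> \oo] --> sigma ->
  asymptotic_variance mu Q = sigma ^+ 2.
Proof.
move=> rs; rewrite /asymptotic_variance.
rewrite (_ : (fun n => _) =
    (fun n => ((norm2 P (q n) / Num.sqrt n%:R) ^+ 2)%:E)); last first.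
  apply/funext => n; rewrite variance_norm2; last exact: cocycle_square_integrable.
  rewrite -EFinM expr_div_n mulrC; congr (_ * _^-1)%:E.
  by rewrite sqr_sqrtr ?ler0n.
set u := (X in limn X); suff -> : limn u = (sigma ^+ 2)%:E by [].
apply/cvg_lim => //; apply: cvg_EFin; first exact: nearW.
by apply: cvgM.
Qed.

Lemma cocycle_clt : weak_cvg
  (fun n => distribution P (normalized_cocycle Q (rate_of_escape mu Q) n))
  (gaussian_law (asymptotic_variance mu Q)).
Proof.
have [l [c [c0 al acl]]] := mean_cocycle_limit.
rewrite (rate_of_escapeP al).
have [c' c'0 qd] := q_defect.
have [sigma [rs _]] : exists s : R, norm2 P (q n) / Num.sqrt n%:R @[n --> \oo] --> s /\
    forall n, (0 < n)%N -> `|norm2 P (q n) / Num.sqrt n%:R - s| <=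
      80 * c' * (Num.sqrt n%:R)^-1.
  apply: cvg_of_dist_le.
    rewrite -(mulr0 (80 * c')); apply: cvgM; first exact: cvg_cst.
    exact: cvg_sqrt_natV.
  move=> n m n0 m0; rewrite -mulrDr.
  exact: (normalized_norm2_dist q_prefix q2 q_mean c'0 qd n0 m0).
rewrite (asymptotic_varianceP rs).
(* [W] has the centering of the statement, [V] the exact one to which the block argument applies. *)
pose W n (w : Om) : R := (Num.sqrt n%:R)^-1 * (Q n w - l * n%:R).
pose V n (w : Om) : R := (Num.sqrt n%:R)^-1 * q n w.
have sW n : square_integrable P (W n).
  apply: square_integrableZ; apply: square_integrableB; last first.
    exact: square_integrable_cst.
  exact: cocycle_square_integrable.
have sV n : square_integrable P (V n) by exact: square_integrableZ.
have WV n : norm2 P (fun w => W n w - V n w) <= c * (Num.sqrt n%:R)^-1.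
  have -> : (fun w => W n w - V n w) = fun=> (Num.sqrt n%:R)^-1 * (a n - l * n%:R).
    by apply/funext => w; rewrite /W /V /q; ring.
  rewrite norm2_cst normrM ger0_norm ?invr_ge0 ?sqrtr_ge0// mulrC.
  by rewrite ler_wpM2r ?invr_ge0 ?sqrtr_ge0.
pose K := 80 * c' + norm2 P (q 1%N).
have K0 : 0 <= K by rewrite addr_ge0 ?norm2_ge0// mulr_ge0.
(* The second moments have to be bounded for every [n]; at [n = 0] the normalizing factor is [0],
   the inverse of [0]. *)
have Wle n : norm2 P (W n) <= K + c.
  have -> : W n = fun w => (W n w - V n w) + V n w.
    by apply/funext => w; rewrite subrK.
  apply: (le_trans (norm2D (square_integrableB (sW n) (sV n)) (sV n))).
  rewrite addrC; apply: lerD.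
    rewrite /V norm2Z// ger0_norm ?invr_ge0 ?sqrtr_ge0//.
    case: n => [|n]; first by rewrite sqrtr0 invr0 mul0r.
    rewrite ler_pdivrMl ?sqrtr_gt0 ?ltr0n// mulrC.
    exact: (norm2_le_sqrt q0 q_prefix q2 q_mean c'0 qd).
  apply: (le_trans (WV n)); case: n => [|n]; first by rewrite sqrtr0 invr0 mulr0.
  rewrite ler_piMr// invf_le1 ?sqrtr_gt0 ?ltr0n//.
  by rewrite -[leLHS]sqrtr1 ler_wsqrtr// ler1n.
have msqr : measurable_fun [set: measurableTypeR R] (fun x : measurableTypeR R => x ^+ 2 : R).
  exact: measurable_funX.
apply: (@weak_cvg_trig _ _ _ ((K + c) ^+ 2)).
- move=> n.
  have [] // := @mean_distribution _ _ _ P (normalized_cocycle Q l n) _ msqr.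
  by case: (sW n).
- move=> n.
  have [|_ ->] := @mean_distribution _ _ _ P (normalized_cocycle Q l n) _ msqr.
    by case: (sW n).
  rewrite -[leLHS]/(mean P (fun w => W n w ^+ 2)) -norm2_sqr.
  apply: lerXn2r; last exact: Wle.
    by rewrite nnegrE norm2_ge0.
  by rewrite nnegrE addr_ge0.
- move=> t b; rewrite mean_cos_gaussian_law ?sqr_ge0//.
  have E n : mean (distribution P (normalized_cocycle Q l n))
      (fun x => cos (t * x + b)) = mean P (fun w => cos (t * W n w + b)).
    have [|_ ->//] := @mean_distribution _ _ _ P (normalized_cocycle Q l n) _
      (measurable_cos_affine t b).
    by apply: integrableR_cos; case: (sW n).
  rewrite (_ : (fun n => mean _ _) =
      (fun n => mean P (fun w => cos (t * W n w + b)))); last exact/funext.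
  have := cvg_mean_cos q0 q_prefix q2 q_mean c'0 qd rs (t := t) (b := b).
  rewrite (_ : (fun n => mean P _) = (fun n => mean P (fun w => cos (t * V n w + b)))).
    move=> VL.
    have D : mean P (fun w => cos (t * W n w + b)) -
        mean P (fun w => cos (t * V n w + b)) @[n --> \oo] --> 0.
      apply: norm_cvg0; apply: (@squeeze_cvgr _ _ _ _ (cst 0)
          (fun n => `|t| * (c * (Num.sqrt n%:R)^-1))).
      + near=> n; rewrite normr_ge0 /=.
        apply: (le_trans (mean_cos_dist t b (sW n) (sV n))).
        by rewrite ler_wpM2l.
      + exact: cvg_cst.
      + rewrite -[X in _ --> X](mulr0 `|t|); apply: cvgM; first exact: cvg_cst.
        rewrite -[X in _ --> X](mulr0 c); apply: cvgM; first exact: cvg_cst.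
        exact: cvg_sqrt_natV.
    rewrite -[X in _ --> X]add0r (_ : (fun n => mean P _) =
      (fun n => (mean P (fun w => cos (t * W n w + b)) -
        mean P (fun w => cos (t * V n w + b))) +
        mean P (fun w => cos (t * V n w + b)))); first exact: cvgD.
    by apply/funext => n; rewrite subrK.
  apply/funext => n; apply: eq_mean => w; rewrite /V; congr cos; ring.
Unshelve. all: by end_near. Qed.

End cocycle.

Theorem theorem4p2 (R : realType) (d : measure_display) (G : measurableType d)
    (mu : probability G R) (Q : adapted_cocycle G R)
    (moment2 : finite_second_moment mu Q)
    (deviation2 : second_moment_deviation mu Q) :
  weak_cvg
    (fun n => distribution (product_measure mu)
                (normalized_cocycle Q (rate_of_escape mu Q) n))
    (gaussian_law (asymptotic_variance mu Q)).
Proof. exact: (cocycle_clt moment2 deviation2). Qed.
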